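(* For any integer $v\geq 7$ with $v\notin\{10,14,18,22,26,30,34,38,42,46,54,58,62,66,74,82,94\}$, there exists a $1\text{-}\mathrm{RQLS}(v)$ with maximal cardinality.
   Context: Write $[v]=\{0,1,\ldots,v-1\}$ and let $\mathcal{H}_v=\mathbb{C}^v$ be the $v$-dimensional complex Hilbert space with its standard Hermitian inner product. A quantum Latin square of order $v$, denoted $\mathrm{QLS}(v)$, is a $v\times v$ array, rows and columns indexed by $[v]$, whose entries are unit vectors of $\mathcal{H}_v$ such that the entries of each row, and the entries of each column, form an orthonormal basis of $\mathcal{H}_v$. Two unit vectors $|\phi\rangle,|\psi\rangle\in\mathcal{H}_v$ are regarded as identical if $|\phi\rangle=e^{\mathrm{i}\theta}|\psi\rangle$ for some real $\theta$, and as distinct otherwise. The cardinality of a $\mathrm{QLS}(v)$ is the number of pairwise distinct vectors (in this sense) among its entries. It has maximal cardinality if its cardinality is $v^2$, i.e. any two entries in different cells are distinct. A transversal of a $\mathrm{QLS}(v)$ is a set of $v$ cells, one in each row and one in each column, whose entries form an orthonormal basis of $\mathcal{H}_v$. Two transversals are disjoint if they have no common cell. For a positive integer $t$, a $\mathrm{QLS}(v)$ is called $t$-resolvable, and denoted $t\text{-}\mathrm{RQLS}(v)$, if it admits $t$ sets $\mathcal{T}^{(r)}=\{T^{(r)}_i: i\in[v]\}$, $r\in[t]$, each consisting of $v$ mutually disjoint transversals, such that $|T^{(r)}_i\cap T^{(s)}_j|=1$ for all $r,s\in[t]$ with $r\ne s$ and all $i,j\in[v]$. In particular, a $1\text{-}\mathrm{RQLS}(v)$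 is a $\mathrm{QLS}(v)$ with $v$ mutually disjoint transversals. *)

(* Defs.v *)
From mathcomp Require Import all_boot all_order all_algebra.
From mathcomp Require Import spectral complex.
From mathcomp Require Import boolp reals trigo.

Set Implicit Arguments.
Unset Strict Implicit.
Unset Printing Implicit Defensive.

Import Order.TTheory GRing.Theory Num.Theory.
Local Open Scope ring_scope.
Local Open Scope complex_scope.

(* The Hilbert space C^v is 'rV[R[i]]_v with the Hermitian product dotmx. *)

Notation cell v := ('I_v * 'I_v)%type.
Notation qarray R v := (cell v -> 'rV[R[i]]_v).

Definition entries_orthonormal_basis (R : realType) (v : nat)
    (Q : qarray R v) (A : {set cell v}) : Prop :=
  (forall c d, c \in A -> d \in A -> dotmx (Q c) (Q d) = (c == d)%:R) /\
  basis_of {: 'rV[R[i]]_v} [seq Q c | c in A].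

Definition row_cells (v : nat) (i : 'I_v) : {set cell v} :=
  [set c | c.1 == i].

Definition col_cells (v : nat) (j : 'I_v) : {set cell v} :=
  [set c | c.2 == j].

Definition is_QLS (R : realType) (v : nat) (Q : qarray R v) : Prop :=
  (forall i, entries_orthonormal_basis Q (row_cells i)) /\
  (forall j, entries_orthonormal_basis Q (col_cells j)).

Definition same_up_to_phase (R : realType) (v : nat)
    (phi psi : 'rV[R[i]]_v) : Prop :=
  exists theta : R, phi = (cos theta +i* sin theta) *: psi.

(* The number of classes of cells under "the entries agree up to phase". *)
Definition QLS_cardinality (R : realType) (v : nat) (Q : qarray R v) : nat :=
  #|[set [set d | `[< same_up_to_phase (Q c) (Q d) >]] | c : cell v]|.

Definition maximal_cardinality (R : realType) (v : nat) (Q : qarray R v) :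
    Prop :=
  QLS_cardinality Q = (v ^ 2)%N.

Definition is_transversal (R : realType) (v : nat) (Q : qarray R v)
    (T : {set cell v}) : Prop :=
  [/\ #|T| = v,
      forall i, #|T :&: row_cells i| = 1%N,
      forall j, #|T :&: col_cells j| = 1%N
    & entries_orthonormal_basis Q T].

Definition is_RQLS (R : realType) (v t : nat) (Q : qarray R v) : Prop :=
  is_QLS Q /\
  exists T : 'I_t -> 'I_v -> {set cell v},
    [/\ forall r i, is_transversal Q (T r i),
        forall r i j, i != j -> [disjoint T r i & T r j]
      & forall r s i j, r != s -> #|T r i :&: T s j| = 1%N].

(* Main.v *)
Require Import Defs.
From HB Require Import structures.
From mathcomp Require Import all_boot all_order all_algebra all_solvable all_field.
From mathcomp Require Import ring zify.
From mathcomp Require Import spectral complex boolp reals trigo.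

Set Implicit Arguments.
Unset Strict Implicit.
Unset Printing Implicit Defensive.

Import Order.TTheory GRing.Theory Num.Theory.
Local Open Scope ring_scope.

(** Row, column and transversal are three coordinates of a cell, any two of
which determine the cell. In these terms a quantum Latin square with [v]
disjoint transversals is a family of [v ^ 2] unit vectors in which two cells
that share a coordinate carry orthogonal vectors, and maximal cardinality says
that no two cells carry proportional vectors. [resolvable_design] is this
symmetric form; [has_design C v] says that one of order [v] exists. Three
ideas settle which orders occur.

Fourier construction. Let [G] be an abelian group of order [v], [e] a
bicharacter of [G], and [sigma] a permutation of [G] such that
[x |-> sigma x + x] is a permutation as well (a complete mapping). Give the
cell [(c, d)] the vector [x |-> e c (sigma x) * e d x], and let the
transversals be the cells with [d - c] constant. For two cells on a line, the
inner product is the sum of a nontrivial character over one of the permutations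
[id], [sigma], [sigma + id], so it vanishes. Two cells carry proportional
vectors only if some [e c (sigma x) * e d x] is constant in [x] with
[(c, d) <> (0, 0)], so [sigma] must be far from affine ([complete_mapping_design]). For a prime
[p >= 7] one can take [sigma x = a * x] on squares and [b * x] on nonsquares,
where [a <> b] come from the pigeonhole principle ([has_design_prime]). Tables
give the orders 9, 12, 15, 16, 20, 25, and order 8 follows by perturbing a
complete mapping that is degenerate in one direction ([has_design_8]).

Wilson's construction ([wilson_fill]). Take a transversal design with [t]
points per group, give every point of four groups (rows, columns, transversals,
basis vectors) weight [m], and keep only [u_1, u_2, ...] points of the other
groups. Fill each block with a design of order [m + h], where [h] counts the
surviving extra points on the block, after normalizing it so that at each extra
point it has a cell with that point as all three coordinates and the
corresponding basis vector as entry; fill each truncated group with a design of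
order [u_i]. The result is a design of order [t * m + u_1 + u_2 + ...].
Deleting the normalized cells makes the blocks interact so little that all
orthogonality relations take place within one block. What has no classical
counterpart is that vectors from different blocks must not be proportional:
before gluing, the vectors of each block are turned by a unitary of [C^m], and
generic unitaries separate finitely many lines ([twists_exist]).

Arithmetic. Without truncation this multiplies the order [m] by any [t] that
has two orthogonal Latin squares, and together with the base orders it yields
all odd [v >= 7] and all multiples of 4 from 8 on. If [v] is 2 mod 4, one
writes [v = 7 * t + u] with [t] coprime to 6 and [7 <= u <= t], which is always
possible for [v >= 280]; the smaller orders are checked one by one, with a few
that need another [m], two truncated groups, or the special transversal designs
on 10 and 15 points ([has_design_of_order]). *)

(** * Hermitian forms and generic unitaries *)

Lemma bij_of_card (A B : finType) : #|A| = #|B| -> exists f : A -> B, bijective f.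
Proof.
move=> e; exists (fun a => enum_val (cast_ord e (enum_rank a))).
exists (fun b => enum_val (cast_ord (esym e) (enum_rank b))) => x;
  by rewrite enum_valK ?cast_ordK ?cast_ordKV enum_rankK.
Qed.

Lemma extend_bij (A B : finType) (H : {set A}) (f : A -> B) :
  #|A| = #|B| -> {in H &, injective f} ->
  exists F : A -> B, bijective F /\ {in H, F =1 f}.
Proof.
move=> eAB finj.
have eC : #|~: H| = #|~: (f @: H)|.
  by rewrite [LHS]cardsCs [RHS]cardsCs !setCK eAB (card_in_imset finj).
case: (pickP A) => [a0 _|A0]; last first.
  by exists f; split=> //; apply: inj_card_bij => [x|]; [case/negP: (A0 x)|rewrite eAB].
set s := enum H ++ enum (~: H).
set s' := map f (enum H) ++ enum (~: (f @: H)).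
have us : uniq s.
  rewrite cat_uniq !enum_uniq andbT /=; apply/hasPn => x.
  by rewrite !mem_enum inE.
have us' : uniq s'.
  rewrite cat_uniq enum_uniq andbT map_inj_in_uniq ?enum_uniq; last first.
    by move=> x y; rewrite !mem_enum; apply: finj.
  apply/hasPn => x; rewrite mem_enum inE => /negP nx; apply/negP => /mapP[y].
  by rewrite mem_enum => yH xe; apply: nx; rewrite xe imset_f.
have ss : size s' = size s.
  by rewrite !size_cat size_map -!cardE eC.
have ms x : x \in s by rewrite mem_cat !mem_enum inE orbN.
exists (fun x => nth (f a0) s' (index x s)); split.
  apply: inj_card_bij; last by rewrite eAB.
  move=> x y /eqP; rewrite nth_uniq ?ss ?index_mem // => /eqP e.
  by rewrite -(nth_index a0 (ms x)) e nth_index.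
move=> x xH; rewrite index_cat mem_enum xH nth_cat size_map index_mem mem_enum xH.
by rewrite (nth_map a0) ?index_mem ?mem_enum // nth_index ?mem_enum.
Qed.

Section Hermitian.
Variable C : numClosedFieldType.
Implicit Types V : finType.

Definition hdot V (f g : V -> C) : C := \sum_s f s * (g s)^*.

Lemma eq_hdot V (f f' g g' : V -> C) : f =1 f' -> g =1 g' -> hdot f g = hdot f' g'.
Proof. by move=> ef eg; apply: eq_bigr => s _; rewrite ef eg. Qed.

Lemma hdot_conj V (f g : V -> C) : (hdot f g)^* = hdot g f.
Proof.
by rewrite rmorph_sum; apply: eq_bigr => s _; rewrite rmorphM /= conjCK mulrC.
Qed.

Lemma hdot_eq0 V (f : V -> C) : hdot f f = 0 -> f =1 fun=> 0.
Proof.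
move=> /eqP; rewrite psumr_eq0 => [/allP h s|s _]; last exact: mul_conjC_ge0.
by have := h s (mem_index_enum _); rewrite mul_conjC_eq0 => /eqP.
Qed.

Lemma hdotDl V (f g h : V -> C) : hdot (fun s => f s + g s) h = hdot f h + hdot g h.
Proof. by rewrite -big_split; apply: eq_bigr => s _; rewrite mulrDl. Qed.

Lemma hdotZl V a (f h : V -> C) : hdot (fun s => a * f s) h = a * hdot f h.
Proof. by rewrite mulr_sumr; apply: eq_bigr => s _; rewrite mulrA. Qed.

Lemma hdotDr V (f g h : V -> C) : hdot h (fun s => f s + g s) = hdot h f + hdot h g.
Proof. by rewrite -!(hdot_conj _ h) hdotDl rmorphD. Qed.

Lemma hdotZr V a (f h : V -> C) : hdot h (fun s => a * f s) = a^* * hdot h f.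
Proof. by rewrite -!(hdot_conj _ h) hdotZl rmorphM. Qed.

Lemma hdot_delta V (f : V -> C) e : hdot f (fun s => (s == e)%:R) = f e.
Proof.
rewrite /hdot (bigD1 e) //= eqxx conjC1 mulr1 big1 ?addr0 // => s /negbTE ->.
by rewrite conjC0 mulr0.
Qed.

(** A square matrix with orthonormal rows has orthonormal columns, so passing to
coordinates in any orthonormal basis preserves the Hermitian form. *)
Lemma parseval V V' (b : V' -> V -> C) (f g : V -> C) :
    #|V'| = #|V| -> (forall x y, hdot (b x) (b y) = (x == y)%:R) ->
  hdot (fun x => hdot f (b x)) (fun x => hdot g (b x)) = hdot f g.
Proof.
move=> eV ob; have [u bu] := bij_of_card eV.
pose B : 'M[C]_#|V'| := \matrix_(i, j) b (enum_val i) (u (enum_val j)).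
pose Bt : 'M[C]_#|V'| := \matrix_(i, j) (b (enum_val j) (u (enum_val i)))^*.
have reix (F : V -> C) : \sum_s F s = \sum_(j < #|V'|) F (u (enum_val j)).
  rewrite (reindex u) /=; last exact: onW_bij.
  by rewrite (reindex (@enum_val V' predT)) //=; apply: onW_bij; exact: enum_val_bij.
have BB : B *m Bt = 1%:M.
  apply/matrixP => i j; rewrite !mxE -(inj_eq enum_val_inj) -ob /hdot reix.
  by apply: eq_bigr => k _; rewrite !mxE.
have complete s t : \sum_x b x s * (b x t)^* = (s == t)%:R.
  case: bu => w uw wu.
  have /matrixP/(_ (enum_rank (w t)) (enum_rank (w s))) := mulmx1C BB.
  rewrite !mxE (inj_eq enum_rank_inj) (can2_eq wu uw) wu eq_sym => <-.
  rewrite (reindex (@enum_val V' predT)) /=; last first.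
    by apply: onW_bij; exact: enum_val_bij.
  by apply: eq_bigr => k _; rewrite !mxE !enum_rankK ?wu mulrC.
transitivity (\sum_s \sum_t f s * (g t)^* * \sum_x b x t * (b x s)^*).
  under [RHS]eq_bigr => s _ do under eq_bigr => t _ do rewrite mulr_sumr.
  under [RHS]eq_bigr => s _ do rewrite exchange_big /=.
  rewrite exchange_big /=; apply: eq_bigr => x _; rewrite hdot_conj.
  rewrite mulr_suml; apply: eq_bigr => s _; rewrite mulr_sumr.
  apply: eq_bigr => t _; ring.
apply: eq_bigr => s _; rewrite (bigD1 s) //= complete eqxx mulr1 big1 ?addr0 //.
by move=> t /negbTE ts; rewrite complete ts mulr0.
Qed.

(** There are arbitrarily many roots of unity. *)
Lemma unit_scalar_avoid (F : seq C) : exists z : C, `|z| = 1 /\ z \notin F.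
Proof.
pose n := (size F).+1.
have [r Er] := closed_field_poly_normal ('X^n - 1 : {poly C}).
have nz : ('X^n - 1 : {poly C}) != 0 by rewrite monic_neq0 ?monicXnsubC.
rewrite (monicP (monicXnsubC _ _)) ?scale1r // in Er.
have sr : size r = n.
  by have := size_XnsubC (1:C) (ltn0Sn (size F)); rewrite Er size_prod_XsubC => -[].
have ur : uniq r.
  rewrite -separable_prod_XsubC -Er; apply: separable_Xn_sub_1.
  by rewrite pnatr_eq0.
have : ~~ all (mem F) r.
  apply/negP => /allP s; have := uniq_leq_size ur s; by rewrite sr ltnn.
move=> /allPn[z zr zF]; exists z; split=> //.
have : root ('X^n - 1) z by rewrite Er root_prod_XsubC.
rewrite rootE !hornerE subr_eq0 => /eqP zn.
by apply/eqP; rewrite -(@pexpr_eq1 _ _ n) // -normrX zn normr1.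
Qed.

(** Chosen one after the other, each scalar has to avoid finitely many values. *)
Lemma unit_scalars_spread (K : finType) (F : seq C) :
  exists z : K -> C, (forall k, `|z k| = 1) /\
                     (forall k l, k != l -> z k / z l \notin F).
Proof.
suff [z [z1 zF]] : exists z : nat -> C, (forall k, `|z k| = 1) /\
    (forall k l, (k < #|K|)%N -> (l < #|K|)%N -> k != l -> z k / z l \notin F).
  exists (fun k => z (enum_rank k)); split=> [k|k l kl] //=.
  by apply: zF => //; rewrite (inj_eq val_inj) (inj_eq enum_rank_inj).
elim: #|K| => [|n [z [z1 zF]]]; first by exists (fun=> 1); split=> // k; rewrite normr1.
have [w [w1 wF]] := unit_scalar_avoid
  ([seq f * z i | f <- F, i <- iota 0 n] ++ [seq z i / f | f <- F, i <- iota 0 n]).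
have z0 i : z i != 0 by rewrite -normr_eq0 z1 oner_eq0.
have w0 : w != 0 by rewrite -normr_eq0 w1 oner_eq0.
exists (fun i => if i == n then w else z i); split=> [k|k l].
  by case: eqP.
rewrite !ltnS => kn ln kl; move: wF; rewrite mem_cat negb_or => /andP[F1 F2].
case: (eqVneq k n) (eqVneq l n) => [ek|nk] [el|nl].
- by rewrite ek el eqxx in kl.
- apply: contra F1 => h; have -> : w = (w / z l) * z l by rewrite divfK.
  by apply: (allpairs_f (fun f i => f * z i)) => //; rewrite mem_iota; lia.
- apply: contra F2 => h; have -> : w = z k / (z k / w) by field; rewrite z0 w0.
  by apply: (allpairs_f (fun f i => z i / f)) => //; rewrite mem_iota; lia.
- by apply: zF => //; lia.
Qed.

(** The vectors [(1, z, z ^ 2, ...)] with [|z| = 1] all have the same norm. A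
given nonzero vector is orthogonal to such a vector only if [z] is a root of a
nonzero polynomial, and proportional to it only if [z] is the quotient of its
first two entries, so all but finitely many [z] work for the whole family. *)
Lemma generic_vector (M J : finType) (phi : J -> M -> C) : (1 < #|M|)%N ->
  exists u : M -> C, hdot u u = #|M|%:R /\
    forall j, (exists m, phi j m != 0) ->
      hdot u (phi j) != 0 /\ forall a, ~ (phi j =1 fun m => a * u m).
Proof.
move=> M1.
have r1 k : (k < 2)%N -> exists m : M, enum_rank m = k :> nat.
  by move=> k2; exists (enum_val (Ordinal (leq_trans k2 M1))); rewrite enum_valK.
have [m0 rm0] := r1 0%N isT; have [m1 rm1] := r1 1%N isT.
pose P j : {poly C} := \poly_(i < #|M|)
   if insub i is Some i' then (phi j (enum_val (i' : 'I_#|M|)))^* else 0.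
have hP j z : hdot (fun m => z ^+ enum_rank m) (phi j) = (P j).[z].
  rewrite horner_poly /hdot (reindex (@enum_val M predT)) /=; last first.
    by apply: onW_bij; exact: enum_val_bij.
  apply: eq_bigr => i _; rewrite enum_valK mulrC insubT //= => lti.
  by congr ((phi j (enum_val _))^* * _); apply: val_inj.
have rts j : exists s : seq C, P j != 0 -> forall z, root (P j) z -> z \in s.
  have [r Er] := closed_field_poly_normal (P j); exists r => nz z.
  by rewrite Er rootZ ?lead_coef_eq0 // root_prod_XsubC.
have [s sP] := fin_all_exists rts.
have [z [z1 zF]] := unit_scalar_avoid
  (flatten [seq s j | j <- enum J] ++ [seq phi j m1 / phi j m0 | j <- enum J]).
have z0 : z != 0 by rewrite -normr_eq0 z1 oner_eq0.
exists (fun m => z ^+ enum_rank m); split.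
  rewrite -[RHS]sumr_const; apply: eq_bigr => m _.
  by rewrite -normCK normrX z1 !expr1n.
move: zF; rewrite mem_cat negb_or => /andP[F1 F2] j [m pm]; split.
  rewrite hP; apply: contra F1 => h; apply/flattenP; exists (s j).
    by apply/mapP; exists j; rewrite ?mem_enum.
  apply: sP => //; apply/eqP => /polyP/(_ (enum_rank m)).
  rewrite coef_poly ltn_ord coef0 insubT => [|lti]; first exact: ltn_ord.
  have -> : Sub (enum_rank m : nat) lti = enum_rank m by apply: val_inj.
  by rewrite enum_rankK => /eqP; rewrite conjC_eq0 (negbTE pm).
move=> a pE; case/negP: F2; apply/mapP; exists j; rewrite ?mem_enum //.
have a0 : a != 0 by apply: contraNneq pm => a0; rewrite pE a0 mul0r.
by rewrite !pE rm0 rm1 expr0 expr1 mulr1 mulrC mulKf.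
Qed.

(** The unitaries multiply a generic vector [u] by a phase [z k] and fix its
orthogonal complement. The nonzero members of the family have nonzero components both
along [u] and across it, and the ratio of these components is turned by [z k];
for [j] and [j'] from different classes, proportionality would put
[z (kap j) / z (kap j')] into a finite set fixed in advance. *)
Lemma twists_exist (M J K : finType) (phi : J -> M -> C) (kap : J -> K) :
    (1 < #|M|)%N ->
  exists W : K -> (M -> C) -> (M -> C),
  [/\ forall k f g, hdot (W k f) (W k g) = hdot f g,
      forall k f g a, W k f =1 (fun m => a * W k g m) -> f =1 (fun m => a * g m)
    & forall j j' a, kap j != kap j' -> (exists m, phi j m != 0) ->
        ~ W (kap j) (phi j) =1 (fun m => a * W (kap j') (phi j') m)].
Proof.
move=> M1; have [u [uu gu]] := generic_vector phi M1.
have n0 : (#|M|%:R : C) != 0 by rewrite pnatr_eq0; lia.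
pose pr f : C := hdot f u / #|M|%:R.
pose perp f m : C := f m - pr f * u m.
have [z [z1 zF]] := unit_scalars_spread K
  [seq perp (phi t.1.1) t.2 / perp (phi t.1.2) t.2 * pr (phi t.1.2) / pr (phi t.1.1)
     | t <- enum ({: J * J * M})].
have zz k : z k * (z k)^* = 1 by rewrite -normCK z1 expr1n.
have z0 k : z k != 0 by rewrite -normr_eq0 z1 oner_eq0.
pose W k f m : C := f m + ((z k - 1) * pr f) * u m.
have hW k f g : hdot (W k f) (W k g) = hdot f g.
  rewrite /W hdotDl !hdotDr !hdotZl !hdotZr uu -(hdot_conj g u) /pr.
  move: (hdot f u) (hdot g u) (hdot f g) => A B D.
  rewrite !rmorphM rmorphB rmorph1 fmorphV /= conjC_nat.
  have zc : (z k)^* = (z k)^-1 by apply: (mulfI (z0 k)); rewrite zz divff.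
  by rewrite zc; field; rewrite n0 z0.
have prW k f : pr (W k f) = z k * pr f.
  rewrite {1}/pr /W hdotDl hdotZl uu /pr; field; exact: n0.
have perpW k f m : perp (W k f) m = perp f m.
  by rewrite /perp prW /W; ring.
have prZ a f : pr (fun m => a * f m) = a * pr f by rewrite /pr hdotZl mulrA.
have prE f g : f =1 g -> pr f = pr g by move=> e; rewrite /pr (eq_hdot e (frefl u)).
exists W; split=> // [k f g a e m|j j' a kj [m0 pj] e].
  have e1 : pr f = a * pr g.
    by have := prE _ _ e; rewrite prZ !prW [RHS]mulrCA => /(mulfI (z0 k)).
  apply: (addIr (((z k - 1) * pr f) * u m)); rewrite -/(W k f m) e /W e1; ring.
have [|up nprop] := gu j; first by exists m0.
have pj0 : pr (phi j) != 0.
  by rewrite mulf_neq0 ?invr_eq0 // -hdot_conj conjC_eq0.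
have [m pm] : exists m, perp (phi j) m != 0.
  apply/existsP; apply: contra_notT (nprop (pr (phi j))).
  rewrite negb_exists => /forallP h m.
  by have := h m; rewrite negbK subr_eq0 => /eqP.
have e1 : z (kap j) * pr (phi j) = a * (z (kap j') * pr (phi j')).
  by have := prE _ _ e; rewrite prZ !prW.
have e2 : perp (phi j) m = a * perp (phi j') m.
  rewrite -(perpW (kap j)) -(perpW (kap j') (phi j')) /perp e mulrBr.
  by rewrite (prE _ _ e) prZ -[in LHS]mulrA.
have pm' : perp (phi j') m != 0 by apply: contraNneq pm => h; rewrite e2 h mulr0.
case/negP: (zF _ _ kj); apply/mapP; exists (j, j', m); rewrite ?mem_enum //=.
rewrite e2 mulfK //; apply: (mulIf pj0); rewrite mulfVK //.
by rewrite mulrAC e1; field; exact: z0.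
Qed.

End Hermitian.

(** * Resolvable designs *)

Inductive line_kind := Row | Col | Tra.

Section Designs.
Variable C : numClosedFieldType.

(** The coordinates of a cell are its row, its column and its transversal.
Treating the three on an equal footing, with an abstract type of cells, spares
separate arguments for them. *)
Definition resolvable_design (V Om : finType) (co : line_kind -> Om -> V) (q : Om -> V -> C) : Prop :=
  [/\ #|Om| = (#|V| ^ 2)%N,
      forall x y, x <> y -> injective (fun o => (co x o, co y o)),
      forall o, hdot (q o) (q o) = 1,
      forall x o o', co x o = co x o' -> o <> o' -> hdot (q o) (q o') = 0
    & forall o o' a, q o =1 (fun s => a * q o' s) -> o = o'].

Definition has_design (n : nat) : Prop :=
  exists (V Om : finType) (co : line_kind -> Om -> V) (q : Om -> V -> C),
    #|V| = n /\ resolvable_design co q.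

(** A frame is a set of cells whose vectors form a basis; [h] of its cells are
required to lie in different rows, columns and transversals. After a change of
basis these [h] cells carry vectors of the standard basis. *)
Definition has_framed_design (n h : nat) : Prop :=
  exists (V Om : finType) (co : line_kind -> Om -> V) (q : Om -> V -> C)
    (b : V -> Om) (S : {set V}),
  [/\ #|V| = n, resolvable_design co q,
      forall x y, hdot (q (b x)) (q (b y)) = (x == y)%:R,
      #|S| = h & forall k, {in S &, injective (fun x => co k (b x))}].

Definition square_co (V : finType) (lab : V -> V -> V) (k : line_kind) (o : V * V) :=
  match k with Row => o.1 | Col => o.2 | Tra => lab o.1 o.2 end.

Lemma coordinates_bij (V Om : finType) (co : line_kind -> Om -> V) (q : Om -> V -> C) x y :
  resolvable_design co q -> x <> y -> bijective (fun o => (co x o, co y o)).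
Proof.
by move=> [cO inj _ _ _] xy; apply: inj_card_bij; [apply: inj|rewrite card_prod cO].
Qed.

(** Normal form of a framed design: the coordinates are renamed so that each
distinguished cell has one and the same name [e] as row, as column and as
transversal, and vectors are expressed in the basis of the frame so that the
entry there is the basis vector [e]. *)
Lemma square_with_holes (n h : nat) (V' : finType) (H : {set V'}) :
    has_framed_design n h -> #|V'| = n -> #|H| = h ->
  exists (lab : V' -> V' -> V') (q : V' * V' -> V' -> C),
    resolvable_design (square_co lab) q /\
    forall e, e \in H -> lab e e = e /\ forall s, q (e, e) s = (s == e)%:R.
Proof.
move=> [V [Om [co [q [b [S [Vn rq ob Sh inj]]]]]]] V'n Hh.
have eV : #|V'| = #|V| by rewrite V'n.
have [cO pinj q1 q0 qp] := rq.
have [g [bg gH]] : exists g : V' -> V, bijective g /\ forall e, e \in H -> g e \in S.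
  have [S0|[s0 s0S]] := set_0Vmem S.
    have [g bg] := bij_of_card eV; exists g; split=> // e.
    by move: Hh; rewrite -Sh S0 cards0 => /cards0_eq ->; rewrite inE.
  pose f e := nth s0 (enum S) (index e (enum H)).
  have fS e : e \in H -> (index e (enum H) < size (enum S))%N.
    by move=> eH; rewrite -cardE Sh -Hh cardE index_mem mem_enum.
  have [|g [bg gf]] := @extend_bij _ _ H f eV.
    move=> e e' eH e'H /eqP; rewrite nth_uniq ?enum_uniq ?fS // => /eqP ee.
    by rewrite -[e](nth_index e (s := enum H)) ?mem_enum // ee nth_index ?mem_enum.
  by exists g; split=> // e eH; rewrite gf // -mem_enum mem_nth ?fS.
have ginj := bij_inj bg.
(* the bijections F rename the coordinates, and Th is induced by them on cells *)
have hF k : exists F : V' -> V, bijective F /\ {in H, F =1 fun e => co k (b (g e))}.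
  by apply: extend_bij => // e e' eH e'H /inj /ginj; apply; apply: gH.
have [F [bF FH]] : exists F : line_kind -> V' -> V,
    (forall k, bijective (F k)) /\ forall k, {in H, F k =1 fun e => co k (b (g e))}.
  have [FR [? ?]] := hF Row; have [FC [? ?]] := hF Col; have [FT [? ?]] := hF Tra.
  by exists (fun k => match k with Row => FR | Col => FC | Tra => FT end); split; case.
have [G GT TG] := bF Tra.
have [T TK KT] := coordinates_bij rq (x := Row) (y := Col) ltac:(by []).
pose Th (o : V' * V') := T (F Row o.1, F Col o.2).
have ThR o : co Row (Th o) = F Row o.1 by have [] := KT (F Row o.1, F Col o.2).
have ThC o : co Col (Th o) = F Col o.2 by have [] := KT (F Row o.1, F Col o.2).
have Thi : injective Th.
  move=> [r c] [r' c'] e; have := ThR (r, c); have := ThC (r, c).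
  by rewrite e ThR ThC /= => /(bij_inj (bF _)) -> /(bij_inj (bF _)) ->.
exists (fun r c => G (co Tra (Th (r, c)))), (fun o s => hdot (q (Th o)) (q (b (g s)))).
set lab := fun r c => _.
have ThL k o : co k (Th o) = F k (square_co lab k o).
  by case: k => //=; rewrite TG -surjective_pairing.
have hh o o' : hdot (fun s => hdot (q (Th o)) (q (b (g s))))
                   (fun s => hdot (q (Th o')) (q (b (g s)))) = hdot (q (Th o)) (q (Th o')).
  by apply: (@parseval _ V V') => // x y; rewrite ob (inj_eq ginj).
split; last first.
  move=> e eH.
  have Te : Th (e, e) = b (g e).
    by apply: (pinj Row Col) => //; rewrite ThR ThC /= !FH.
  by split=> [|s]; rewrite ?Te /lab ?Te -?FH // ?GT // ob (inj_eq ginj) eq_sym.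
split.
- by rewrite card_prod.
- move=> x y xy o o' [e1 e2]; apply: Thi; apply: (pinj x y) => //.
  by rewrite !ThL e1 e2.
- by move=> o; rewrite hh.
- move=> x o o' e oo'; rewrite hh; apply: (q0 x); first by rewrite !ThL e.
  by move=> /Thi.
- move=> o o' a e; apply: Thi; apply: (qp _ _ a) => s.
  apply/eqP; rewrite -subr_eq0; apply/eqP.
  have : hdot (fun s => q (Th o) s + - a * q (Th o') s) (fun s => q (Th o) s + - a * q (Th o') s) = 0.
    rewrite -(@parseval _ V V' (fun x => q (b (g x)))) //; last first.
      by move=> x y; rewrite ob (inj_eq ginj).
    apply: big1 => t _.
    have := e t; rewrite !hdotDl !hdotZl => ->.
    by rewrite mulNr subrr mul0r.
  by move=> /hdot_eq0 /(_ s); rewrite mulNr.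
Qed.

(** The cells of any row form a frame. *)
Lemma row_frame (V Om : finType) (co : line_kind -> Om -> V) (q : Om -> V -> C) :
    resolvable_design co q ->
  exists b : V -> Om, forall x y, hdot (q (b x)) (q (b y)) = (x == y)%:R.
Proof.
move=> rq; have [cO pinj q1 q0 qp] := rq.
case: (pickP V) => [v0 _|V0]; last first.
  have nV (v : V) : False by have := V0 v.
  by exists (fun v => False_rect Om (nV v)) => x; case: (nV x).
have [T TK KT] := coordinates_bij rq (x := Row) (y := Col) ltac:(by []).
exists (fun x => T (v0, x)) => x y.
have [->|xy] := eqVneq x y; first exact: q1.
apply: (q0 Row) => [|e].
  by have [-> _] := KT (v0, x); have [-> _] := KT (v0, y).
by have [_] := KT (v0, x); rewrite e; have [_ ->] := KT (v0, y) => e'; rewrite e' eqxx in xy.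
Qed.

Lemma has_framed_design0 n : has_design n -> has_framed_design n 0.
Proof.
move=> [V [Om [co [q [Vn rq]]]]]; have [b ob] := row_frame rq.
exists V, Om, co, q, b, set0; split=> //; first by rewrite cards0.
by move=> k x y; rewrite inE.
Qed.

Lemma has_framed_design1 n : (0 < n)%N -> has_design n -> has_framed_design n 1.
Proof.
move=> n0 [V [Om [co [q [Vn rq]]]]]; have [b ob] := row_frame rq.
have [v0 _] : exists v0 : V, v0 \in V by apply/card_gt0P; rewrite Vn.
exists V, Om, co, q, b, [set v0]; split=> //; first by rewrite cards1.
by move=> k x y /set1P -> /set1P ->.
Qed.

End Designs.

(** * Wilson's construction *)

(** Blocks are indexed by [T * T], and [psi x b] is the point of the block [b] in
the group [x] of a transversal design. Its groups are the symbol group [None],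
three groups for rows, columns and transversals, and the groups in [G], which
are truncated to the sets [U g] of extra points [E]. The local points [L] of a
block are those of [M], placed over the point of the block in each of the first
four groups, and its extra points. The index type [K] contains also one block
for each [g : G], consisting of the extra points of that group. *)
Section Wilson.
Variable C : numClosedFieldType.
Variables (T M G : finType) (psi : option line_kind + G -> T * T -> T).
Variable (U : G -> {set T}) (t0 : T).
Hypothesis M1 : (1 < #|M|)%N.
Hypothesis psi_inj : forall x y, x <> y -> injective (fun b => (psi x b, psi y b)).

Let E := {p : G * T | p.2 \in U p.1}.
Let P := (T * M + E)%type.
Let L := (M + E)%type.
Let K := (T * T + G)%type.
Let gr (e : E) : G := (val e).1.

Definition on_block (k : K) (l : L) : bool :=
  match k, l with
  | inl b, inl m => true
  | inl b, inr e => psi (inr (gr e)) b == (val e).2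
  | inr g, inl m => false
  | inr g, inr e => gr e == g
  end.

(** Only the blocks of the transversal design have holes. The blocks of [G] supply
the cells that the holes leave out. *)
Definition hole_point (k : K) (l : L) : bool :=
  match k, l with inl _, inr _ => true | _, _ => false end.

Lemma hole_point_inl k m : hole_point k (inl m) = false.
Proof. by case: k. Qed.

(** Where a local point of a block lands in the index set of the coordinate [x];
extra points are shared by all blocks and coordinates. The value [t0] fills a
case that does not occur: a block of [G] has no point in [M]. *)
Definition place (x : option line_kind) (k : K) (l : L) : P :=
  match l with
  | inl m => inl (if k is inl b then psi (inl x) b else t0, m)
  | inr e => inr e
  end.

Lemma place_inj x k : injective (place x k).
Proof. by move=> [m|e] [m'|e'] //= [->]. Qed.

(** Two extra points of different groups lie on one block of the transversal
design, two extra points of the same group only on the block of this group. *)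
Lemma extra_block e e' k k' :
  on_block k (inr e) -> on_block k (inr e') ->
  on_block k' (inr e) -> on_block k' (inr e') ->
  ((e == e') && hole_point k (inr e)) = false ->
  ((e == e') && hole_point k' (inr e)) = false -> k = k'.
Proof.
have ext (x y : E) : gr x = gr y -> (val x).2 = (val y).2 -> x = y.
  by move=> h1 h2; apply: val_inj; apply: injective_projections.
have diff b x y : on_block (inl b) (inr x) -> on_block (inl b) (inr y) ->
    x != y -> gr x != gr y.
  move=> /eqP h1 /eqP h2; apply: contra => /eqP h; apply/eqP/ext => //.
  by rewrite -h1 -h2 h.
case: k k' => [b|g] [b'|g'] /=; rewrite ?andbT ?andbF => h1 h2 h3 h4 /negbT n1 /negbT n2.
- have gg := diff b e e' h1 h2 n1; congr inl.
  apply: (@psi_inj (inr (gr e)) (inr (gr e'))); first by move=> [h]; rewrite h eqxx in gg.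
  by rewrite (eqP h1) (eqP h2) (eqP h3) (eqP h4).
- by have := diff b e e' h1 h2 n1; rewrite (eqP h3) (eqP h4) eqxx.
- by have := diff b' e e' h3 h4 n2; rewrite (eqP h1) (eqP h2) eqxx.
- by rewrite -(eqP h1) -(eqP h3).
Qed.

(** The combinatorial core: a pair of points in two different coordinates is
covered by a single block, provided that pairs consisting twice of the same
extra point are disregarded in the blocks of the transversal design. *)
Lemma block_unique x y k k' a b a' b' : x <> y ->
  on_block k a -> on_block k b -> on_block k' a' -> on_block k' b' ->
  place x k a = place x k' a' -> place y k b = place y k' b' ->
  ~ (a = b /\ hole_point k a) -> ~ (a' = b' /\ hole_point k' a') -> k = k'.
Proof.
move=> xy; case: a a' => [m|e] [m'|e'] //; case: b b' => [n|f] [n'|f'] //.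
- case: k k' => [c|g] [c'|g'] //= _ _ _ _ [h1 _] [h2 _] _ _; congr inl.
  by apply: (@psi_inj (inl x) (inl y)); rewrite ?h1 ?h2 // => -[].
- case: k k' => [c|g] [c'|g'] //= _ /eqP h2 _ /eqP h4 [h _] [ff] _ _; congr inl.
  apply: (@psi_inj (inl x) (inr (gr f))) => //.
  by rewrite -ff in h4; rewrite h h2 h4.
- case: k k' => [c|g] [c'|g'] //= /eqP h1 _ /eqP h3 _ [ee] [h _] _ _; congr inl.
  apply: (@psi_inj (inl y) (inr (gr e))) => //.
  by rewrite -ee in h3; rewrite h h1 h3.
- move=> h1 h2 h3 h4 [ee] [ff]; rewrite -ee in h3 *; rewrite -ff in h4 *.
  move=> n1 n2; apply: (@extra_block e f); rewrite //; apply/negP => /andP[/eqP ef hh].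
    by apply: n1; rewrite ef in hh *.
  by apply: n2; rewrite ef in hh *.
Qed.

Definition block (k : K) : finType := {l : L | on_block k l}.
Definition holes (k : K) : {set block k} := [set l | hole_point k (val l)].

(** An extra point on the block is determined by its group. *)
Lemma card_holes b : #|holes (inl b)| = #|[set g | psi (inr g) b \in U g]|.
Proof.
pose g (l : block (inl b)) : option G := if val l is inr e then Some (gr e) else None.
have gi : {in holes (inl b) &, injective g}.
  move=> [[m|e] h] [[m'|e'] h']; rewrite !inE //= => _ _ [].
  rewrite /g /= => gg; apply: val_inj => /=; congr inr; apply: val_inj.
  by apply: injective_projections; rewrite // -(eqP h) -(eqP h') gg.
have si : injective (@Some G) by move=> ? ? [].
rewrite -(card_in_imset gi) -(card_imset _ si); apply: eq_card => o.
apply/imsetP/imsetP => [[[[m|e] h]]|[x]]; rewrite !inE //= => h'.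
  move=> ->; exists (gr e) => //; rewrite inE (eqP h); exact: (valP e).
move=> ->; have h : on_block (inl b) (inr (exist _ (x, psi (inr x) b) h') : L) by rewrite /=.
by exists (exist (fun l => on_block (inl b) l) _ h) => //; rewrite inE.
Qed.

Lemma card_block_inl b : #|block (inl b)| = (#|M| + #|holes (inl b)|)%N.
Proof.
rewrite -cardsT -(cardsID (holes (inl b))) setTI addnC; congr (_ + _)%N.
pose f (m : M) : block (inl b) := exist (on_block (inl b)) (inl m) isT.
have fi : injective f by move=> x y [].
rewrite -(card_imset _ fi); apply: eq_card => l; rewrite !inE andbT.
apply/idP/imsetP => [|[m _ ->] //]; case: l => -[m|e] h //= _.
by exists m => //; apply: val_inj.
Qed.

Lemma card_block_inr g : #|block (inr g)| = #|U g|.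
Proof.
pose f (l : block (inr g)) : option T := if val l is inr e then Some (val e).2 else None.
have fi : injective f.
  move=> [[m|e] h] [[m'|e'] h'] //= []; rewrite /f /= => ee; apply: val_inj => /=.
  congr inr; apply: val_inj; apply: injective_projections => //.
  exact: etrans (eqP h) (esym (eqP h')).
have si : injective (@Some T) by move=> ? ? [].
rewrite -cardsT -(card_imset _ fi) -(card_imset _ si); apply: eq_card => o.
apply/imsetP/imsetP => [[[[m|e] h]] // _ ->|[x xU ->]].
  by exists (val e).2 => //; rewrite -(eqP h); exact: (valP e).
have h : on_block (inr g) (inr (exist _ (g, x) xU) : L) by rewrite /=.
by exists (exist (fun l => on_block (inr g) l) _ h).
Qed.

Lemma holes_inr g : holes (inr g) = set0.
Proof. by apply/setP => -[[m|e] h]; rewrite !inE. Qed.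

Hypothesis fill_blocks : forall b, has_framed_design C
   (#|M| + #|[set g | psi (inr g) b \in U g]|) #|[set g | psi (inr g) b \in U g]|.
Hypothesis fill_groups : forall g, has_design C #|U g|.

(** A design on the points of the block, normalized at its extra points. *)
Definition block_design (k : K)
    (d : (block k -> block k -> block k) * (block k * block k -> block k -> C)) :=
  resolvable_design (square_co d.1) d.2 /\
  forall e, e \in holes k -> d.1 e e = e /\ forall s, d.2 (e, e) s = (s == e)%:R.

Lemma block_designs_exist : exists D, forall k, @block_design k (D k).
Proof.
apply: fin_all_exists => -[b|g].
  have [] := @square_with_holes C _ _ (block (inl b)) (holes (inl b)) (fill_blocks b).
  - by rewrite card_block_inl card_holes.
  - exact: card_holes.
  by move=> lab [q h]; exists (lab, q).
have [] := @square_with_holes C _ _ (block (inr g)) (holes (inr g)) (has_framed_design0 (fill_groups g)).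
- exact: card_block_inr.
- by rewrite holes_inr cards0.
by move=> lab [q h]; exists (lab, q).
Qed.

Section Glue.
Variable D : forall k, (block k -> block k -> block k) * (block k * block k -> block k -> C).
Hypothesis HD : forall k, @block_design k (D k).

Let lab k := (D k).1.
Let q k := (D k).2.
Arguments lab k : clear implicits.
Arguments q k : clear implicits.

Definition amp k o (l : L) : C := if insub l is Some l' then q k o l' else 0.

Arguments amp k o l : clear implicits.

Definition body k o (m : M) : C := amp k o (inl m).
Arguments body k o m : clear implicits.

Definition hole_cell k (o : block k * block k) := (o.1 == o.2) && (o.1 \in holes k).
Arguments hole_cell k o : clear implicits.

Lemma amp_val k o (l : block k) : amp k o (val l) = q k o l.
Proof. by rewrite /amp valK. Qed.

Lemma amp_on k o l : amp k o l != 0 -> on_block k l.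
Proof. by rewrite /amp; case: insubP => [//|_]; rewrite eqxx. Qed.

Lemma hdot_amp k o o' :
  hdot (q k o) (q k o') =
  hdot (body k o) (body k o') + \sum_(e : E) amp k o (inr e) * (amp k o' (inr e))^*.
Proof.
transitivity (\sum_(l : L) amp k o l * (amp k o' l)^*); last by rewrite big_sumType.
rewrite [RHS](bigID (on_block k)) /= [X in _ + X]big1 ?addr0; last first.
  by move=> l; rewrite /amp => /negbTE h; rewrite insubF // mul0r.
rewrite (reindex_omap (val : block k -> L) insub) /=; last first.
  by move=> l h; rewrite insubT.
apply: eq_big => [l|l _]; last by rewrite !amp_val.
by rewrite valK eqxx (valP l).
Qed.

(** The hole on a line carries the basis vector of the extra point [l], and all
other cells of the line are orthogonal to it. *)
Lemma hole_free k o x l (c := square_co (lab k) x o) :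
  ~~ hole_cell k o -> c = l -> amp k o (val l) != 0 -> ~ (hole_point k (val l)).
Proof.
move=> no cl a0 hl; have lh : l \in holes k by rewrite inE.
have [[cO pinj q1 q0 qp] hh] := HD k; have [ll ql] := hh l lh.
have : hdot (q k o) (q k (l, l)) = 0.
  apply: (q0 x); first by rewrite -/lab -/c cl; case: (x) => //=.
  by move=> oe; move: no; rewrite oe /hole_cell eqxx lh.
rewrite (eq_hdot (frefl _) ql) hdot_delta => h; move: a0.
by rewrite amp_val h eqxx.
Qed.

(** Otherwise the vector would be proportional to the one in the hole. *)
Lemma amp_single k o (l : block k) : ~~ hole_cell k o -> hole_point k (val l) ->
  exists l', l' != l /\ amp k o (val l') != 0.
Proof.
move=> no hl; have lh : l \in holes k by rewrite inE.
have [[cO pinj q1 q0 qp] hh] := HD k; have [ll ql] := hh l lh.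
have [/existsP[l' /andP[h1 h2]]|/existsPn n] :=
    boolP [exists l', (l' != l) && (amp k o (val l') != 0)]; first by exists l'.
case/negP: no; have -> : o = (l, l); last by rewrite /hole_cell eqxx lh.
apply: (qp _ _ (amp k o (val l))) => s; rewrite ql -/(q k o s) -amp_val.
have := n s; rewrite negb_and !negbK; case: eqP => [->|_ /= /eqP ->].
  by rewrite mulr1.
by rewrite mulr0.
Qed.

Lemma amp_neq0 k o : exists l : block k, amp k o (val l) != 0.
Proof.
have [[cO pinj q1 q0 qp] hh] := HD k.
apply/existsP; apply: contraTT (oner_neq0 C) => /existsPn n.
rewrite negbK -(q1 o) /hdot big1 // => s _.
by have := n s; rewrite negbK amp_val => /eqP; rewrite /q => ->; rewrite mul0r.
Qed.

Section Twisted.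
Variable W : K -> (M -> C) -> M -> C.
Hypothesis hW : forall k f g, hdot (W k f) (W k g) = hdot f g.
Hypothesis lW : forall k f g a, W k f =1 (fun m => a * W k g m) -> f =1 (fun m => a * g m).
Hypothesis sW : forall k k' o o' a, k != k' -> (exists m, body k o m != 0) ->
  ~ W k (body k o) =1 (fun m => a * W k' (body k' o') m).

(** The local vector transported to the global basis, with its [M]-part turned by
the unitary of the block. *)
Definition vec k o (s : P) : C :=
  match s with
  | inl (t, m) =>
      if k is inl b then if psi (inl None) b == t then W k (body k o) m else 0 else 0
  | inr e => amp k o (inr e)
  end.
Arguments vec k o s : clear implicits.

Lemma body_group g o m : body (inr g) o m = 0.
Proof. by rewrite /body /amp insubF. Qed.

Lemma hdot_vec k o o' : hdot (vec k o) (vec k o') = hdot (q k o) (q k o').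
Proof.
rewrite hdot_amp [LHS]big_sumType /=; congr (_ + _).
case: k o o' => [b|g] o o' /=; last first.
  rewrite big1 => [|[t m] _]; last by rewrite mul0r.
  by rewrite /hdot big1 // => m _; rewrite body_group mul0r.
rewrite -(hW (inl b)).
transitivity (\sum_t \sum_m vec (inl b) o (inl (t, m)) * (vec (inl b) o' (inl (t, m)))^*).
  by rewrite pair_bigA /=; apply: eq_bigr => -[t m] _.
rewrite (bigD1 (psi (inl None) b)) //= eqxx.
rewrite [X in _ + X]big1 ?addr0 // => t /negbTE tb; rewrite big1 // => m _.
by rewrite eq_sym tb mul0r.
Qed.

Lemma vec_supp k o s : vec k o s != 0 ->
  exists l, [/\ on_block k l, s = place None k l & forall e, l = inr e -> amp k o l != 0].
Proof.
case: s => [[t m]|e] /=; last first.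
  by move=> h; exists (inr e); split=> //; exact: amp_on h.
case: k o => [b|g] o; last by rewrite eqxx.
case: (psi (inl None) b =P t) => [<- h|_]; last by rewrite eqxx.
by exists (inl m).
Qed.

(** A basis vector in the support of both vectors would, together with the shared
coordinate, form a pair covered by two blocks. *)
Lemma vec_cross k k' o o' x s : k <> k' -> ~~ hole_cell k o -> ~~ hole_cell k' o' ->
    place (Some x) k (val (square_co (lab k) x o)) =
    place (Some x) k' (val (square_co (lab k') x o')) ->
  vec k o s * (vec k' o' s)^* = 0.
Proof.
move=> kk no no' e; apply/eqP; rewrite mulf_eq0 conjC_eq0.
apply/norP => -[/vec_supp[l [kl sl hl]] /vec_supp[l' [kl' sl' hl']]]; apply: kk.
apply: (@block_unique (Some x) None _ _ _ l _ l') e _ _ _ => //; try exact: valP.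
- by rewrite -sl -sl'.
- move=> [cl hc]; apply: (hole_free (x := x) no erefl); last exact: hc.
  by move: hl hc; rewrite cl; case: (l) => [m|f] hl; [rewrite hole_point_inl|move=> _; apply: hl].
- move=> [cl hc]; apply: (hole_free (x := x) no' erefl); last exact: hc.
  by move: hl' hc; rewrite cl; case: (l') => [m|f] hl'; [rewrite hole_point_inl|move=> _; apply: hl'].
Qed.

Lemma vec_nz k o : exists s, vec k o s != 0.
Proof.
have [[cO pinj q1 q0 qp] hh] := HD k.
apply/existsP; apply: contraTT (oner_neq0 C) => /existsPn n.
rewrite negbK -(q1 o) -hdot_vec /hdot big1 // => s _.
by have := n s; rewrite negbK => /eqP ->; rewrite mul0r.
Qed.

(** The vector is supported on the extra points, by normalization not on a single
one. *)
Lemma vec_two b o : ~~ hole_cell (inl b) o -> (forall m, body (inl b) o m = 0) ->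
  exists e e', [/\ e != e', amp (inl b) o (inr e) != 0 & amp (inl b) o (inr e') != 0].
Proof.
move=> no b0; have [[l0 kl] hl] := amp_neq0 o.
case: l0 kl hl => [m|e] kl; first by rewrite -/(body _ _ _) b0 eqxx.
move=> hl; have [[l0 kl'] [ll hl']] := @amp_single (inl b) o (exist _ (inr e : L) kl) no isT.
case: l0 kl' ll hl' => [m|e'] kl' ll hl'; first by rewrite -/(body _ _ _) b0 eqxx in hl'.
exists e, e'; split=> //; apply: contra ll => /eqP ee; apply/eqP/val_inj => /=.
by rewrite ee.
Qed.

(** Proportional vectors have the same support. If the [M]-part is zero, the
support contains two extra points, which determine the block. If it is not, the
blocks have the same symbol point, and the unitaries [W] separate them. *)
Lemma vec_prop_block k k' o o' a : ~~ hole_cell k o -> ~~ hole_cell k' o' ->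
  vec k o =1 (fun s => a * vec k' o' s) -> k = k'.
Proof.
have half (b : T * T) k0 o0 o0' a0 : ~~ hole_cell (inl b) o0 -> a0 != 0 ->
    vec (inl b) o0 =1 (fun s => a0 * vec k0 o0' s) -> inl b = k0.
  move=> no a0n e.
  have [b0|/forallPn[m bm]] := boolP [forall m, body (inl b) o0 m == 0].
    have [f [f' [ff h1 h2]]] := vec_two no (fun m => eqP (forallP b0 m)).
    have h1' : amp k0 o0' (inr f) != 0.
      by apply: contraNneq h1 => h; have := e (inr f); rewrite /= h mulr0 => ->.
    have h2' : amp k0 o0' (inr f') != 0.
      by apply: contraNneq h2 => h; have := e (inr f'); rewrite /= h mulr0 => ->.
    by apply: (@extra_block f f'); rewrite ?(negbTE ff) //; apply: amp_on; eauto.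
  have Wn : exists m, W (inl b) (body (inl b) o0) m != 0.
    apply/existsP; apply: contraNT bm => /existsPn n; apply/eqP.
    have : hdot (body (inl b) o0) (body (inl b) o0) = 0.
      rewrite -(hW (inl b)) /hdot big1 // => i _.
      by have := n i; rewrite negbK => /eqP ->; rewrite mul0r.
    by move/hdot_eq0.
  case: Wn => m1 Wm1; case: k0 o0' e => [b'|g] o0' e; last first.
    by have := e (inl (psi (inl None) b, m1)); rewrite /= eqxx mulr0 => h; rewrite h eqxx in Wm1.
  apply/eqP; apply/negPn/negP => bb.
  apply: (@sW (inl b) (inl b') o0 o0' a0 bb); first by exists m.
  have bb' : psi (inl None) b' = psi (inl None) b.
    apply/eqP; apply: contraNT Wm1 => /negbTE n.
    by have := e (inl (psi (inl None) b, m1)); rewrite /= eqxx n mulr0 => ->.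
  by move=> m2; have := e (inl (psi (inl None) b, m2)); rewrite /= bb' eqxx.
move=> no no' e.
have a0 : a != 0.
  have [s] := vec_nz o; apply: contraNneq => a0; by rewrite e a0 mul0r.
case: k o no e => [b|g] o no e; first exact: half no a0 e.
case: k' o' no' e => [b'|g'] o' no' e.
  apply/esym/(@half b' _ o' o a^-1); rewrite ?invr_eq0 // => s.
  by rewrite e mulKf.
have [[[m|f] kl] hl] := amp_neq0 o; first by [].
have h' : amp (inr g') o' (inr f) != 0.
  by apply: contraNneq hl => h; have := e (inr f); rewrite /= h mulr0 => ->.
by have /eqP <- := kl; have /eqP <- := amp_on h'.
Qed.

(** The holes are left out: the corresponding pairs of extra points are covered by
the blocks of [G]. *)
Definition cells : finType := {k : K & {o : block k * block k | ~~ hole_cell k o}}.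

Definition cell_co x (c : cells) : P :=
  place (Some x) (tag c) (val (square_co (lab (tag c)) x (val (tagged c)))).

Definition cell_vec (c : cells) : P -> C := vec (tag c) (val (tagged c)).

Lemma cell_co_inj x y : x <> y -> injective (fun c => (cell_co x c, cell_co y c)).
Proof.
move=> xy [k [o no]] [k' [o' no']]; rewrite /cell_co /= => -[e1 e2].
have hol j (p : block j * block j) : ~~ hole_cell j p ->
    ~ (val (square_co (lab j) x p) = val (square_co (lab j) y p) /\
       hole_point j (val (square_co (lab j) x p))).
  move=> np [/val_inj e h]; set l := square_co _ x p in e h.
  have lh : l \in holes j by rewrite inE.
  have [[cO pinj q1 q0 qp] hh] := HD j; have [ll ql] := hh l lh.
  case/negP: np; have -> : p = (l, l); last by rewrite /hole_cell eqxx lh.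
  apply: (pinj x y xy); rewrite -/(lab j) -/l -e; congr (_, _).
    by case: (x) => //=.
  by case: (y) => //=.
have kk : k = k'.
  apply: (@block_unique (Some x) (Some y) _ _ _ _ _ _ _ _ _ _ _ e1 e2);
    rewrite ?(valP (square_co _ _ _)) //; [by case|exact: hol|exact: hol].
case: _ / kk in o' no' e1 e2 *.
move: e1 e2 => /place_inj/val_inj e1 /place_inj/val_inj e2.
have [[cO pinj _ _ _] _] := HD k.
have eo : o = o' by apply: (pinj x y xy); rewrite -/(lab k) e1 e2.
by rewrite -eo in no' *; rewrite (bool_irrelevance no no').
Qed.

Lemma cell_cover : forall p p', exists c : cells, cell_co Row c = p /\ cell_co Col c = p'.
Proof.
have mk k (a b : block k) : ~~ hole_cell k (a, b) ->
    exists c : cells, cell_co Row c = place (Some Row) k (val a) /\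
                      cell_co Col c = place (Some Col) k (val b).
  by move=> no; exists (Tagged (fun k => {o : block k * block k | ~~ hole_cell k o})
     (exist (fun o => ~~ hole_cell k o) (a, b) no)).
have mkL k (a b : L) : on_block k a -> on_block k b -> ~~ ((a == b) && hole_point k a) ->
    exists c : cells, cell_co Row c = place (Some Row) k a /\
                      cell_co Col c = place (Some Col) k b.
  move=> ka kb no; apply: (mk k (exist (fun l => on_block k l) a ka)
      (exist (fun l => on_block k l) b kb)).
  by rewrite /hole_cell inE.
have solve x y t t' : x <> y -> exists b, psi x b = t /\ psi y b = t'.
  move=> xy; have [|g gK Kg] := @inj_card_bij _ _ _ (psi_inj xy); first by rewrite !card_prod.
  by have [] := Kg (t, t'); exists (g (t, t')).
case=> [[t m]|e] [[t' m']|e'].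
- have [b [<- <-]] := solve (inl (Some Row)) (inl (Some Col)) t t' ltac:(by []).
  by apply: (mkL (inl b) (inl m) (inl m')); rewrite //= andbF.
- have [b [<- h]] := solve (inl (Some Row)) (inr (gr e')) t (val e').2 ltac:(by []).
  by apply: (mkL (inl b) (inl m) (inr e')); rewrite //= h.
- have [b [<- h]] := solve (inl (Some Col)) (inr (gr e)) t' (val e).2 ltac:(by []).
  by apply: (mkL (inl b) (inr e) (inl m')); rewrite //= h.
- have [ee|ne] := eqVneq (gr e) (gr e').
    by apply: (mkL (inr (gr e)) (inr e) (inr e')); rewrite //= ?ee ?eqxx ?andbF.
  have [|b [h h']] := solve (inr (gr e)) (inr (gr e')) (val e).2 (val e').2.
    by move=> [h]; rewrite h eqxx in ne.
  apply: (mkL (inl b) (inr e) (inr e')); rewrite //= ?h ?h' // andbT.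
  by apply: contra ne => /eqP [->].
Qed.

(** By [block_unique] the coordinates are injective, and each pair of points does
lie on a block, so cells correspond to pairs of points. *)
Lemma card_cells : #|cells| = (#|{: P}| ^ 2)%N.
Proof.
rewrite -mulnn -card_prod.
have [f fK] := fin_all_exists (fun p : P * P => cell_cover p.1 p.2).
apply: (@bij_eq_card _ _ (fun c => (cell_co Row c, cell_co Col c))); exists f.
  apply: inj_can_sym; last exact: cell_co_inj.
  by move=> p; have [-> ->] := fK p; rewrite -surjective_pairing.
by move=> p; have [-> ->] := fK p; rewrite -surjective_pairing.
Qed.

Lemma cells_rqls : resolvable_design cell_co cell_vec.
Proof.
split.
- exact: card_cells.
- exact: cell_co_inj.
- by move=> [k [o no]]; rewrite /cell_vec /= hdot_vec; have [[_ _ h _ _] _] := HD k; exact: h.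
- move=> x [k [o no]] [k' [o' no']]; rewrite /cell_co /cell_vec /= => e ne.
  have [kk|/eqP kk] := eqVneq k k'; last first.
    by apply: big1 => s _; apply: (vec_cross s kk no no' e).
  case: _ / kk in o' no' e ne *; rewrite hdot_vec.
  have [[_ _ _ h _] _] := HD k; apply: (h x); first by move/place_inj/val_inj: e.
  by move=> eo; case: _ / eo in no' ne; apply: ne; rewrite (bool_irrelevance no no').
move=> [k [o no]] [k' [o' no']] a; rewrite /cell_vec /= => e.
have kk := vec_prop_block no no' e; case: _ / kk in o' no' e *.
suff eo : o = o' by case: _ / eo in no' e *; rewrite (bool_irrelevance no no').
have [[_ _ _ _ h] _] := HD k; apply: (h _ _ a) => l; rewrite -!/(q k _ _) -!amp_val.
case: l => -[m|f] kl /=; last exact: (e (inr f)).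
apply: (@lW k (body k o) (body k o') a) => m'; clear h.
case: k o no o' no' e kl => [b|g] o no o' no' e kl //.
by have := e (inl (psi (inl None) b, m')); rewrite /= eqxx.
Qed.

End Twisted.
End Glue.

Lemma card_points : #|{: P}| = (#|T| * #|M| + \sum_g #|U g|)%N.
Proof.
rewrite card_sum card_prod; congr addn; rewrite card_sig -sum1_card.
rewrite -(pair_big_dep xpredT (fun g t => t \in U g) (fun _ _ => 1%N)) /=.
by apply: eq_bigr => g _; rewrite sum1_card.
Qed.

Lemma wilson_fill : has_design C (#|T| * #|M| + \sum_g #|U g|).
Proof.
have [D HD] := block_designs_exist.
have [W [hW lW sW]] := @twists_exist C M {k : K & (block k * block k)%type} K
  (fun j => body D (tagged j)) (fun j => tag j) M1.
have := cells_rqls HD hW lW; set co := cell_co _; set vc := cell_vec _ _ => rq.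
exists P, cells, co, vc; split; first exact: card_points.
apply: rq => k k' o o' a kk.
exact: (sW (Tagged (fun k => block k * block k)%type o)
           (Tagged (fun k => block k * block k)%type o')).
Qed.

End Wilson.

(** * Transversal designs *)

Section TransversalDesigns.
Local Open Scope nat_scope.

(** A transversal design with [r] groups of size [t], that is, [r - 2] mutually
orthogonal Latin squares of order [t]. The index of the group is a natural
number so that designs can be restricted to fewer groups. *)
Definition has_TD (r t : nat) : Prop :=
  exists (T : finType) (psi : nat -> T * T -> T), #|T| = t /\
    forall x y, x < r -> y < r -> x <> y -> injective (fun b => (psi x b, psi y b)).

Lemma inj_swap (A B : Type) (f g : A -> B) :
  injective (fun b => (f b, g b)) -> injective (fun b => (g b, f b)).
Proof. by move=> h a b [e1 e2]; apply: h; rewrite e1 e2. Qed.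

Lemma TD_prod r s t : has_TD r s -> has_TD r t -> has_TD r (s * t).
Proof.
move=> [S [f [Ss fi]]] [T [g [Tt gi]]].
exists (S * T)%type, (fun x b => (f x (b.1.1, b.2.1), g x (b.1.2, b.2.2))); split.
  by rewrite card_prod Ss Tt.
move=> x y xr yr xy [[a1 a2] [b1 b2]] [[c1 c2] [d1 d2]] /= [e1 e2 e3 e4].
have [-> ->] : (a1, b1) = (c1, d1) by apply: (fi x y) => //=; rewrite e1 e3.
by have [-> ->] : (a2, b2) = (c2, d2) by apply: (gi x y) => //=; rewrite e2 e4.
Qed.

Lemma ord_coprime_mul0 n (u : 'I_n.+1) k : coprime n.+1 k -> (u *+ k = 0)%R -> u = 0%R.
Proof.
move=> co; rewrite Zp_mulrn => /(congr1 val) /= /eqP; rewrite -/(dvdn _ _) => h.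
apply: val_inj => /=; move: h; rewrite Gauss_dvdl // /dvdn modn_small; last exact: ltn_ord.
by move/eqP.
Qed.

(** The groups are the vertical direction and the lines of slopes [0], ...,
[r - 1] in the plane over the integers mod [n.+1]. *)
Lemma TD_linear r n : (forall k, 0 < k < r -> coprime n.+1 k) -> has_TD r.+1 n.+1.
Proof.
move=> co; exists 'I_n.+1, (fun x b => if x is k.+1 then b.1 + b.2 *+ k else b.2)%R.
split; first exact: card_ord.
have main k l : k < l < r ->
    injective (fun b : 'I_n.+1 * 'I_n.+1 => (b.1 + b.2 *+ k, b.1 + b.2 *+ l)%R).
  move=> /andP[kl lr] [a b] [c d] e.
  have e1 : (a + b *+ k = c + d *+ k)%R := congr1 fst e.
  have e2 : (a + b *+ l = c + d *+ l)%R := congr1 snd e.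
  have bd : (b - d = 0)%R.
    apply: (@ord_coprime_mul0 n _ (l - k)); first by apply: co; lia.
    apply/eqP; rewrite mulrnBl subr_eq0 !mulrnBr ?(ltnW kl) //; apply/eqP.
    have : (a + b *+ l - (a + b *+ k) = c + d *+ l - (c + d *+ k))%R by rewrite e1 e2.
    by rewrite !opprD !(addrACA _ (_ *+ l)%R) !subrr !add0r.
  by move/eqP: bd; rewrite subr_eq0 => /eqP bd; move: e1; rewrite bd => /addIr ->.
have zero k : injective (fun b : 'I_n.+1 * 'I_n.+1 => (b.2, b.1 + b.2 *+ k)%R).
  move=> [a b] [c d] e; have bd : b = d := congr1 fst e.
  have e2 : (a + b *+ k = c + d *+ k)%R := congr1 snd e.
  by move: e2; rewrite bd => /addIr ->.
move=> [|k] [|l] xr yr xy; [by case: xy|exact: (zero l)|exact: inj_swap (zero k)|].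
have [kl|kl|kl] := ltngtP k l; last by rewrite kl in xy.
  by apply: main; lia.
by apply: inj_swap; apply: main; lia.
Qed.

Lemma TD4_odd t : odd t -> has_TD 4 t.
Proof.
case: t => // n on; apply: TD_linear => -[|[|[|k]]] // _; first exact: coprimen1.
by rewrite coprimen2.
Qed.

Lemma TD6_coprime6 t : 0 < t -> coprime t 6 -> has_TD 6 t.
Proof.
case: t => // n _; rewrite (coprimeMr _ 2 3) => /andP[c2 c3].
apply: TD_linear => -[|[|[|[|[|k]]]]] // _; first exact: coprimen1.
by rewrite (coprimeMr _ 2 2) c2.
Qed.

Lemma TD_le r r' t : r' <= r -> has_TD r t -> has_TD r' t.
Proof.
move=> rr [T [f [Tt fi]]]; exists T, f; split=> // x y xr yr; apply: fi; lia.
Qed.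

Definition td_check (r t : nat) (f : nat -> nat -> nat -> nat) : bool :=
  all (fun x => all (fun i => all (fun j => f x i j < t) (iota 0 t)) (iota 0 t) &&
    all (fun y => uniq [seq f x p.1 p.2 * t + f y p.1 p.2 |
          p <- [seq (i, j) | i <- iota 0 t, j <- iota 0 t]])
        (iota 0 x)) (iota 0 r).

Lemma uniq_map_inj (A B : eqType) (f : A -> B) (s : seq A) :
  uniq (map f s) -> {in s &, injective f}.
Proof.
move=> u x y xs ys e; have i : index x s = index y s.
  apply/eqP; rewrite -(nth_uniq (f x) _ _ u) ?size_map ?index_mem //.
  by rewrite !(nth_map x) ?index_mem // !nth_index // e.
by rewrite -(nth_index x xs) i nth_index.
Qed.

Lemma TD_check r t f : td_check r t.+1 f -> has_TD r t.+1.
Proof.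
move=> /allP chk; pose psi x (b : 'I_t.+1 * 'I_t.+1) : 'I_t.+1 := inord (f x b.1 b.2).
have io (i : 'I_t.+1) : (i : nat) \in iota 0 t.+1 by rewrite mem_iota ltn_ord.
have flt x (i j : 'I_t.+1) : x < r -> f x i j < t.+1.
  move=> xr; have /chk/andP[/allP h _] : x \in iota 0 r by rewrite mem_iota.
  by have /allP h' := h _ (io i); exact: h' (io j).
have psiE x b : x < r -> val (psi x b) = f x b.1 b.2.
  by move=> xr; rewrite /= inordK ?flt.
have lt x y : y < x < r -> injective (fun b => (psi x b, psi y b)).
  move=> /andP[yx xr] [a b] [c d] [] /(congr1 val) e1 /(congr1 val) e2.
  have yr := ltn_trans yx xr.
  rewrite !psiE //= in e1; rewrite !psiE //= in e2.
  have /chk/andP[_ /allP h] : x \in iota 0 r by rewrite mem_iota.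
  have {}h := h y; rewrite mem_iota in h; have {}h := h yx.
  have cell (i j : 'I_t.+1) : ((i : nat), (j : nat)) \in
      [seq (i, j) | i <- iota 0 t.+1, j <- iota 0 t.+1].
    by apply: (allpairs_f (fun i j => (i, j))); apply: io.
  have [] : ((a : nat), (b : nat)) = ((c : nat), (d : nat)).
    by apply: (uniq_map_inj h) => //=; rewrite e1 e2.
  by move=> /val_inj -> /val_inj ->.
exists 'I_t.+1, psi; split=> [|x y xr yr xy]; first exact: card_ord.
have [h|h|//] := ltngtP x y.
  by apply/inj_swap/lt; lia.
by apply: lt; lia.
Qed.

(** For the orders 4 and 8 the groups are slopes over the field of that order. An
element is coded by the bits of its coordinates, so that addition is the bitwise
exclusive or; the list tabulates the product with a generator. *)
Lemma TD4_4 : has_TD 4 4.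
Proof.
apply: (@TD_check 4 3 (fun x i j => match x with 0 => i | 1 => j | 2 => Nat.lxor i j
  | _ => Nat.lxor i (nth 0 [:: 0; 2; 3; 1] j) end)).
by vm_compute.
Qed.

Lemma TD4_8 : has_TD 4 8.
Proof.
apply: (@TD_check 4 7 (fun x i j => match x with 0 => i | 1 => j | 2 => Nat.lxor i j
  | _ => Nat.lxor i (nth 0 [:: 0; 2; 4; 6; 3; 1; 7; 5] j) end)).
by vm_compute.
Qed.

(** Two orthogonal Latin squares of order 10 (Parker), superimposed as tens digit
and units digit. *)
Definition parker : seq (seq nat) :=
 [:: [:: 00; 47; 18; 76; 29; 93; 85; 34; 61; 52];
     [:: 86; 11; 57; 28; 70; 39; 94; 45; 02; 63];
     [:: 95; 80; 22; 67; 38; 71; 49; 56; 13; 04];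
     [:: 59; 96; 81; 33; 07; 48; 72; 60; 24; 15];
     [:: 73; 69; 90; 82; 44; 17; 58; 01; 35; 26];
     [:: 68; 74; 09; 91; 83; 55; 27; 12; 46; 30];
     [:: 37; 08; 75; 19; 92; 84; 66; 23; 50; 41];
     [:: 14; 25; 36; 40; 51; 62; 03; 77; 88; 99];
     [:: 21; 32; 43; 54; 65; 06; 10; 89; 97; 78];
     [:: 42; 53; 64; 05; 16; 20; 31; 98; 79; 87]].

Lemma TD4_10 : has_TD 4 10.
Proof.
apply: (@TD_check 4 9 (fun x i j => match x with 0 => i | 1 => j
  | 2 => nth 0 (nth [::] parker i) j %/ 10 | _ => nth 0 (nth [::] parker i) j %% 10 end)).
by vm_compute.
Qed.

(** The lists and the linear forms [0] and [j] are rows of a difference matrix over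
the integers mod 15: any two of them differ by a permutation. *)
Lemma TD5_15 : has_TD 5 15.
Proof.
apply: (@TD_check 5 14 (fun x i j => match x with 0 => j | 1 => i | 2 => (i + j) %% 15
  | 3 => (i + nth 0 [:: 0; 2; 5; 7; 9; 12; 4; 1; 14; 11; 3; 6; 8; 10; 13] j) %% 15
  | _ => (i + nth 0 [:: 0; 6; 3; 14; 10; 7; 13; 4; 11; 2; 8; 5; 1; 12; 9] j) %% 15 end)).
by vm_compute.
Qed.

Lemma TD4_mul4 t : 0 < t -> 4 %| t -> has_TD 4 t.
Proof.
elim/ltn_ind: t => t IH t0 d4; have [d16|n16] := boolP (16 %| t).
  have -> : t = 4 * (t %/ 4) by lia.
  by apply: TD_prod TD4_4 (IH _ _ _ _); lia.
have [d8|n8] := boolP (8 %| t).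
  have -> : t = 8 * (t %/ 8) by lia.
  by apply: TD_prod TD4_8 (TD4_odd _); lia.
have -> : t = 4 * (t %/ 4) by lia.
by apply: TD_prod TD4_4 (TD4_odd _); lia.
Qed.

End TransversalDesigns.

(** * Designs from complete mappings of abelian groups *)

Section Phases.
Variable C : numClosedFieldType.

(** Vectors with entries of modulus one become unit vectors when divided by the
square root of their length. *)
Lemma phase_design (V Om : finType) (co : line_kind -> Om -> V) (f : Om -> V -> C) :
    (0 < #|V|)%N -> #|Om| = (#|V| ^ 2)%N ->
    (forall x y, x <> y -> injective (fun o => (co x o, co y o))) ->
    (forall o s, `|f o s| = 1) ->
    (forall x o o', co x o = co x o' -> o <> o' -> hdot (f o) (f o') = 0) ->
    (forall o o' a, f o =1 (fun s => a * f o' s) -> o = o') ->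
  exists q : Om -> V -> C, resolvable_design co q /\
    forall o o', hdot (q o) (q o') = hdot (f o) (f o') / #|V|%:R.
Proof.
move=> V0 cO pinj f1 f0 fp; pose c : C := (sqrtC #|V|%:R)^-1.
have n0 : (#|V|%:R : C) != 0 by rewrite pnatr_eq0 -lt0n.
have c0 : c != 0 by rewrite invr_eq0 sqrtC_eq0.
have hq o o' : hdot (fun s => c * f o s) (fun s => c * f o' s) =
    hdot (f o) (f o') / #|V|%:R.
  rewrite hdotZl hdotZr mulrA -normCK ger0_norm ?invr_ge0 ?sqrtC_ge0 ?ler0n //.
  by rewrite exprVn sqrtCK mulrC.
exists (fun o s => c * f o s); split=> //; split=> //.
- move=> o; rewrite hq.
  have -> : hdot (f o) (f o) = #|V|%:R.
    by rewrite -[RHS]sumr_const; apply: eq_bigr => s _; rewrite -normCK f1 expr1n.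
  by rewrite divff.
- by move=> x o o' e ne; rewrite hq (f0 x) // mul0r.
- move=> o o' a e; apply: (fp _ _ a) => s; apply: (mulfI c0).
  by rewrite e mulrCA.
Qed.

Section CompleteMapping.
Variables (G : finZmodType) (e : G -> G -> C) (sig : G -> G).
Hypothesis e1 : forall c x, `|e c x| = 1.
Hypothesis eDl : forall c d x, e (c + d) x = e c x * e d x.
Hypothesis eDr : forall c x y, e c (x + y) = e c x * e c y.
Hypothesis e_nontriv : forall c, c != 0 -> exists x, e c x != 1.
Hypothesis sig_inj : injective sig.
Hypothesis sigD_inj : injective (fun x => sig x + x).
Hypothesis sig_nonaffine : forall c d,
  (forall x, e c (sig x) * e d x = e c (sig 0) * e d 0) -> c = 0 /\ d = 0.

Definition cm_lab (c d : G) : G := d - c.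

(** Up to normalization, the entry of the cell in row [c] and column [d]. *)
Definition cm_phase (o : G * G) (x : G) : C := e o.1 (sig x) * e o.2 x.

Lemma bichar_neq0 c x : e c x != 0.
Proof. by rewrite -normr_eq0 e1 oner_eq0. Qed.

Lemma bichar0l x : e 0 x = 1.
Proof. by apply: (mulfI (bichar_neq0 0 x)); rewrite -eDl addr0 mulr1. Qed.

Lemma bichar0r c : e c 0 = 1.
Proof. by apply: (mulfI (bichar_neq0 c 0)); rewrite -eDr addr0 mulr1. Qed.

Lemma bicharNl c x : e (- c) x = (e c x)^-1.
Proof. by apply: (mulfI (bichar_neq0 c x)); rewrite -eDl subrr bichar0l divff ?bichar_neq0. Qed.

Lemma bicharNr c x : e c (- x) = (e c x)^-1.
Proof. by apply: (mulfI (bichar_neq0 c x)); rewrite -eDr subrr bichar0r divff ?bichar_neq0. Qed.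

Lemma bichar_conj c x : (e c x)^* = e (- c) x.
Proof. by rewrite bicharNl invC_norm e1 expr1n invr1 mul1r. Qed.

(** A shift of the argument multiplies the sum by a scalar that can be chosen
different from one. *)
Lemma bichar_sum c (t : G -> G) : c != 0 -> injective t -> \sum_x e c (t x) = 0.
Proof.
move=> c0 ti; have [y ey] := e_nontriv c0.
rewrite -(reindex_inj (P := xpredT) (F := e c) ti) /=.
have E : \sum_x e c x = e c y * \sum_x e c x.
  rewrite [LHS](reindex_inj (addrI y)) mulr_sumr /=.
  by apply: eq_bigr => x _; rewrite eDr.
apply/eqP; move/eqP: E; rewrite -subr_eq0 -{1}[X in X - _]mul1r -mulrBl mulf_eq0 subr_eq0.
by rewrite eq_sym (negbTE ey).
Qed.

Lemma cm_hdot o o' : hdot (cm_phase o) (cm_phase o') =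
  \sum_x e (o.1 - o'.1) (sig x) * e (o.2 - o'.2) x.
Proof.
by apply: eq_bigr => x _; rewrite /cm_phase rmorphM /= !bichar_conj !eDl; ring.
Qed.

(** On a line of cells on which the character [d] is the character [c] composed
with [k], the inner product is a character sum over the permutation
[sig + k]. *)
Lemma cm_orthogonal o o' (k : G -> G) (c := o.1 - o'.1) : c != 0 ->
    (forall x, e (o.2 - o'.2) x = e c (k x)) -> injective (fun x => sig x + k x) ->
  hdot (cm_phase o) (cm_phase o') = 0.
Proof.
move=> c0 hk ti; rewrite cm_hdot -/c -[RHS](bichar_sum c0 ti).
by apply: eq_bigr => x _; rewrite hk eDr.
Qed.

(** Rows use the permutation [id], columns [sig], and the transversals, where the
differences in [c] and in [d] agree, [sig + id]. *)
Lemma complete_mapping_design : exists q : G * G -> G -> C,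
  resolvable_design (square_co cm_lab) q /\
  forall o o', hdot (q o) (q o') = hdot (cm_phase o) (cm_phase o') / #|G|%:R.
Proof.
apply: phase_design.
- by apply/card_gt0P; exists 0.
- by rewrite card_prod.
- case=> -[] // _ [c d] [c' d'] /= []; rewrite /cm_lab.
  + by move=> -> ->.
  + by move=> -> /addIr ->.
  + by move=> -> ->.
  + by move=> -> /addrI/oppr_inj ->.
  + by move=> /[swap] -> /addIr ->.
  + by move=> /[swap] -> /addrI/oppr_inj ->.
- by move=> o x; rewrite normrM !e1 mulr1.
- move=> x [c d] [c' d'] h ne.
  have [cc|cc] := eqVneq c c'.
    rewrite cc in h ne *; rewrite cm_hdot /= subrr.
    have dd : d - d' != 0.
      by rewrite subr_eq0; apply: contra_notN ne => /eqP ->.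
    transitivity (\sum_x e (d - d') (id x)); last exact: bichar_sum.
    by apply: eq_bigr => y _; rewrite bichar0l mul1r.
  have c0 : c - c' != 0 by rewrite subr_eq0.
  case: x h => /= h.
  + by rewrite h eqxx in cc.
  + apply: (@cm_orthogonal (c, d) (c', d') (fun=> 0)) => //= [x|x y].
      by rewrite h subrr bichar0l bichar0r.
    by rewrite !addr0; exact: sig_inj.
  + apply: (@cm_orthogonal (c, d) (c', d') id) => //= x.
    rewrite -[d](subrK c) -[d'](subrK c') -/(cm_lab c d) h /cm_lab; congr (e _ _).
    by rewrite opprD addrACA subrr add0r.
move=> [c d] [c' d'] a h.
have hx x : e (c - c') (sig x) * e (d - d') x = a.
  rewrite !eDl !bicharNl; have := h x; rewrite /cm_phase /= => hh.
  rewrite mulrACA hh -mulrA [X in a * X]mulrC.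
  rewrite -[RHS]mulr1; congr (a * _).
  by field; rewrite !bichar_neq0.
have [|/eqP] := @sig_nonaffine (c - c') (d - d'); first by move=> x; rewrite !hx.
by rewrite subr_eq0 => /eqP -> /eqP; rewrite subr_eq0 => /eqP ->.
Qed.

End CompleteMapping.
End Phases.

(** * Prime orders *)

(** Multiplication by one of two constants, according to the quadratic character
[eta]. *)
Section FieldOrthomorphism.
Variable F : finFieldType.
Let eta (x : F) := x ^+ (#|F|.-1./2).

Definition class_mul (a b x : F) : F := if eta x == 1 then a * x else b * x.

Lemma eta_M x y : eta (x * y) = eta x * eta y.
Proof. by rewrite /eta exprMn. Qed.

Hypothesis oddF : odd #|F|.
Hypothesis F7 : (7 <= #|F|)%N.

Lemma eta_neq0 x : (eta x == 0) = (x == 0).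
Proof. rewrite /eta expf_eq0; case: (x == 0); rewrite ?andbF //; lia. Qed.

Lemma eta_sign x : x != 0 -> (eta x == 1) || (eta x == -1).
Proof.
move=> x0; rewrite -sqrf_eq1 -exprM.
have -> : (#|F|.-1./2 * 2 = #|F|.-1)%N by lia.
apply/eqP; apply: (mulfI x0); rewrite -exprS prednK ?mulr1 ?expf_card //; lia.
Qed.

Lemma eta_eq a b : a != 0 -> b != 0 -> (eta a == 1) = (eta b == 1) -> eta a = eta b.
Proof.
move=> /eta_sign a1 /eta_sign b1; case: eqP a1 => [->|_] /=.
  by move=> _ /esym/eqP.
by move=> /eqP -> h; move: b1; rewrite -h => /eqP.
Qed.

(** The quadratic character of the image gives away the one of the argument, and
hence the constant that was used. *)
Lemma class_mul_inj a b : a != 0 -> b != 0 -> eta a = eta b -> injective (class_mul a b).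
Proof.
move=> a0 b0 ab x y e.
have e2 : eta x = eta y.
  have h z : eta (class_mul a b z) = eta a * eta z.
    by rewrite /class_mul; case: ifP; rewrite eta_M ?ab.
  by have := congr1 eta e; rewrite !h => /mulfI -> //; rewrite eta_neq0.
by move: e; rewrite /class_mul e2; case: ifP => _ /mulfI; apply.
Qed.

Lemma class_mulD a b x : class_mul a b x + x = class_mul (a + 1) (b + 1) x.
Proof. by rewrite /class_mul; case: ifP => _; rewrite mulrDl mul1r. Qed.

Lemma nonresidue : exists x : F, (x != 0) && (eta x != 1).
Proof.
apply/existsP; apply: contraT => /existsPn h.
have nz : ('X^(#|F|.-1./2) - 1 : {poly F}) != 0.
  by rewrite monic_neq0 // monicXnsubC; lia.
have := max_poly_roots nz (rs := enum (predC1 (0 : F))).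
have -> : all (root ('X^(#|F|.-1./2) - 1)) (enum (predC1 (0 : F))).
  apply/allP => x; rewrite mem_enum inE => x0; rewrite rootE !hornerE subr_eq0.
  by have := h x; rewrite x0 negbK.
rewrite enum_uniq -cardE cardC1 size_XnsubC => [/(_ isT isT)|]; move: F7; case: #|F| => [|n] //=; lia.
Qed.

(** Constants with [eta a = eta b] and [eta (a + 1) = eta (b + 1)] exist because
at least 5 elements [a] with [a <> 0] and [a + 1 <> 0] share 4 pairs of signs. *)
Lemma orthomorphism_coefs : exists a b : F,
  [/\ a != b, injective (class_mul a b) & injective (fun x => class_mul a b x + x)].
Proof.
pose A := [set a : F | (a != 0) && (a + 1 != 0)].
pose f (a : F) := (eta a == 1, eta (a + 1) == 1).
have cA : (4 < #|A|)%N.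
  have -> : A = ~: [set 0; -1].
    by apply/setP => a; rewrite !inE negb_or addr_eq0.
  have e : addn #|[set (0 : F); -1]| #|~: [set (0 : F); -1]| = #|F| := cardsC _.
  by move: F7; rewrite -e cards2; case: (_ != _); rewrite ?addSn ?add0n !ltnS // => /ltnW.
have : ~~ dinjectiveb f A.
  apply/dinjectiveP => fi; have := max_card (mem (f @: A)).
  by rewrite (card_in_imset fi) card_prod card_bool leqNgt cA.
case/dinjectivePn=> a; rewrite inE => /andP[a0 a1] [b]; rewrite !inE => /and3P[ba b0 b1].
move=> [e1 e2]; exists a, b; split; first by rewrite eq_sym.
  by apply: class_mul_inj => //; apply: eta_eq.
move=> x y; rewrite !class_mulD; apply: class_mul_inj => //; exact: eta_eq.
Qed.

End FieldOrthomorphism.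

Section Bases.
Variable C : numClosedFieldType.

Lemma prim_root_exists n : (0 < n)%N -> exists z : C, n.-primitive_root z.
Proof.
move=> n0; have [r Er] := closed_field_poly_normal ('X^n - 1 : {poly C}).
rewrite (monicP (monicXnsubC _ n0)) scale1r in Er.
have ur : uniq r.
  rewrite -separable_prod_XsubC -Er; apply: separable_Xn_sub_1.
  by rewrite pnatr_eq0 -lt0n.
have sr : size r = n.
  by have := size_XnsubC (1:C) n0; rewrite Er size_prod_XsubC => -[].
have /hasP[z _ pz] : has n.-primitive_root r; last by exists z.
apply: has_prim_root; rewrite ?sr //; apply/allP => z zr.
by rewrite /root_of_unity Er root_prod_XsubC.
Qed.

Lemma prim_root_norm n (z : C) : n.-primitive_root z -> `|z| = 1.
Proof.
move=> pz; apply/eqP; rewrite -(@pexpr_eq1 _ _ n) ?normr_ge0 //.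
  by rewrite -normrX (prim_expr_order pz) normr1.
exact: prim_order_gt0 pz.
Qed.

Lemma has_design_card (V Om : finType) (co : line_kind -> Om -> V) (q : Om -> V -> C) :
  resolvable_design co q -> has_design C #|V|.
Proof. by move=> h; exists V, Om, co, q. Qed.

(** If [c * sigma x + d * x] is constant, it is zero; evaluated at [1] and at a
nonresidue, this gives [c * a + d = 0] and [c * b + d = 0], so [c = d = 0]. *)
Lemma has_design_prime p : prime p -> (7 <= p)%N -> has_design C p.
Proof.
move=> pp p7; have cF : #|'F_p| = p by rewrite card_Fp.
have oF : odd #|'F_p| by rewrite cF; have := even_prime pp; lia.
have F7 : (7 <= #|'F_p|)%N by rewrite cF.
have [z pz] := prim_root_exists (prime_gt0 pp).
have [a [b [ab i1 i2]]] := orthomorphism_coefs oF F7.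
pose chi (u : 'F_p) : C := z ^+ u.
have chiD u v : chi (u + v) = chi u * chi v.
  rewrite /chi -exprD -(prim_expr_mod pz (addn u v)) /=; congr (z ^+ modn _ _).
  exact: Fp_cast pp.
have chi1 u : chi u = 1 -> u = 0.
  rewrite /chi -(expr0 z) => /eqP; rewrite (eq_prim_root_expr pz) mod0n => /eqP h.
  apply: val_inj; rewrite /= -h modn_small //.
  by move: (ltn_ord u); move: (nat_of_ord u) => k; rewrite (Fp_cast pp).
have chi0 : chi 0 = 1 by rewrite /chi expr0.
have [|||||q [rq _]] := @complete_mapping_design C _ (fun c x : 'F_p => chi (c * x))
  (class_mul a b) _ _ _ _ i1 i2 _; last by rewrite -[p]cF; exact: has_design_card rq.
- by move=> c x; rewrite /chi normrX (prim_root_norm pz) expr1n.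
- by move=> c d x; rewrite mulrDl chiD.
- by move=> c x y; rewrite mulrDr chiD.
- move=> c c0; exists 1; rewrite mulr1; apply: contraNneq c0 => /chi1 ->; exact: eqxx.
move=> c d h.
have h' x : c * class_mul a b x + d * x = 0.
  by apply: chi1; rewrite chiD h /class_mul !(mulr0, if_same) chi0 mulr1.
have := h' 1; rewrite /class_mul expr1n eqxx !mulr1 => e1.
have [g /andP[g0 ng]] := nonresidue oF F7.
have := h' g; rewrite /class_mul (negbTE ng) mulrA -mulrDl => /eqP.
rewrite mulf_eq0 (negbTE g0) orbF => /eqP e2.
have c0 : c = 0.
  have /eqP : c * (a - b) = 0.
    by rewrite mulrBr -[c * a](addrK d) e1 -[c * b](addrK d) e2 subrr.
  by rewrite mulf_eq0 subr_eq0 (negbTE ab) orbF => /eqP.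
by split=> //; move: e1; rewrite c0 mul0r add0r.
Qed.

End Bases.

(** * Small orders from tables *)

HB.instance Definition _ (G H : finZmodType) := Finite.on (G * H)%type.

(** Over the group of pairs in [Z_A * Z_B], where [B = k * A], the pair [(x, y)] is
coded by [x * B + y], a permutation by the list [s] of its values, and the
bicharacter is a power of a primitive [B]-th root of unity. *)
Section Table.
Local Open Scope nat_scope.

Variables (a b k : nat) (s : seq nat).
Let A := a.+1.
Let B := b.+1.

Definition tab_add i j := ((i %/ B + j %/ B) %% A) * B + (i %% B + j %% B) %% B.
Definition tab_opp i := ((A - i %/ B) %% A) * B + (B - i %% B) %% B.
Definition tab_exp c x := k * (c %/ B) * (x %/ B) + (c %% B) * (x %% B).

Definition table_bij (t : nat -> nat) :=
  let l := [seq t i | i <- iota 0 (A * B)] in uniq l && all (fun j => j < A * B) l.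

Definition table_nonaffine :=
  all (fun c => all (fun d =>
    ((c == 0) && (d == 0)) ||
    has (fun x => (tab_exp c (nth 0 s x) + tab_exp d x) %% B !=
                  (tab_exp c (nth 0 s 0) + tab_exp d 0) %% B) (iota 0 (A * B)))
    (iota 0 (A * B))) (iota 0 (A * B)).

Definition table_ok := [&& B == k * A, table_bij (nth 0 s),
  table_bij (fun i => tab_add (nth 0 s i) i) & table_nonaffine].

Definition table_mate := table_bij (fun i => tab_add (nth 0 s i) (tab_opp i)) &&
  table_bij (fun i => tab_add i i).

Let G : finZmodType := ('I_A * 'I_B)%type.
Definition tab_enc (x : G) : nat := x.1 * B + x.2.
Definition tab_dec i : G := (inord (i %/ B), inord (i %% B)).

Lemma tab_encK : cancel tab_enc tab_dec.
Proof.
move=> [x y]; rewrite /tab_enc /tab_dec /= divnMDl // modnMDl divn_small // modn_small // addn0.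
by rewrite !inord_val.
Qed.

Lemma tab_enc_lt x : tab_enc x < A * B.
Proof. by case: x => x y; rewrite /tab_enc /=; have := ltn_ord x; have := ltn_ord y; nia. Qed.

Lemma tab_decK i : i < A * B -> tab_enc (tab_dec i) = i.
Proof.
move=> h; rewrite /tab_enc /tab_dec /= !inordK ?ltn_mod // ?ltn_divLR //.
by rewrite -divn_eq.
Qed.

Lemma tab_enc_div x : tab_enc x %/ B = x.1.
Proof. by rewrite /tab_enc divnMDl // divn_small // addn0. Qed.

Lemma tab_enc_mod x : tab_enc x %% B = x.2.
Proof. by rewrite /tab_enc modnMDl modn_small. Qed.

Lemma tab_encD (x y : G) : tab_enc (x + y)%R = tab_add (tab_enc x) (tab_enc y).
Proof. by rewrite /tab_add !tab_enc_div !tab_enc_mod. Qed.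

Lemma tab_encN (x : G) : tab_enc (- x)%R = tab_opp (tab_enc x).
Proof. by rewrite /tab_opp !tab_enc_div !tab_enc_mod. Qed.

Lemma table_bij_inj t : table_bij t -> injective (fun x : G => tab_dec (t (tab_enc x))).
Proof.
move=> /andP[u /allP lt] x y e.
have lt' z : t (tab_enc z) < A * B.
  by apply: lt; apply: map_f; rewrite mem_iota tab_enc_lt.
have : t (tab_enc x) = t (tab_enc y) by rewrite -(tab_decK (lt' x)) e tab_decK.
move=> {}e; apply: (can_inj tab_encK); apply/eqP.
rewrite -(nth_uniq 0 _ _ u) ?size_map ?size_iota ?tab_enc_lt //.
by rewrite !(nth_map 0) ?size_iota ?tab_enc_lt // !nth_iota ?tab_enc_lt // !add0n e.
Qed.

Variable C : numClosedFieldType.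
Hypothesis ok : table_ok.
Variable z : C.
Hypothesis pz : (B.-primitive_root z)%R.

Definition tab_sig (x : G) : G := tab_dec (nth 0 s (tab_enc x)).
Definition tab_char (c x : G) : C := (z ^+ tab_exp (tab_enc c) (tab_enc x))%R.

Lemma tab_sig_enc x : tab_enc (tab_sig x) = nth 0 s (tab_enc x).
Proof.
case/and4P: ok => _ /andP[_ /allP lt] _ _; rewrite tab_decK //.
by apply: lt; apply: map_f; rewrite mem_iota tab_enc_lt.
Qed.

Local Open Scope ring_scope.

Lemma tab_charE c x : tab_char c x = ((z ^+ k) ^+ c.1) ^+ x.1 * (z ^+ c.2) ^+ x.2.
Proof. by rewrite /tab_char /tab_exp !tab_enc_div !tab_enc_mod exprD -!exprM mulnA. Qed.

Lemma tab_root_order : (z ^+ k) ^+ A = 1.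
Proof. by case/and4P: ok => /eqP e _ _ _; rewrite -exprM -e (prim_expr_order pz). Qed.

Lemma tab_charDl c d x : tab_char (c + d) x = tab_char c x * tab_char d x.
Proof.
rewrite !tab_charE /= (expr_mod _ tab_root_order) (expr_mod _ (prim_expr_order pz)).
by rewrite !exprD !exprMn; ring.
Qed.

Lemma tab_charC c x : tab_char c x = tab_char x c.
Proof.
rewrite !tab_charE -!exprM.
by congr (z ^+ (k * _)%N * z ^+ _); apply: mulnC.
Qed.

Lemma tab_charDr c x y : tab_char c (x + y) = tab_char c x * tab_char c y.
Proof. by rewrite ![tab_char c _]tab_charC tab_charDl. Qed.

Lemma tab_char_norm c x : `|tab_char c x| = 1.
Proof. by rewrite normrX (prim_root_norm pz) expr1n. Qed.

Lemma tab_char_nontriv c : c != 0 -> exists x, tab_char c x != 1.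
Proof.
case: c => c1 c2 c0.
have [h|h] := eqVneq c2 0.
  have h1 : c1 != 0 by apply: contraNneq c0 => h1; rewrite h h1.
  have [a0|a0] := posnP a.
    by case/eqP: h1; apply: val_inj => /=; have := ltn_ord c1; rewrite /A; lia.
  exists (inord 1, 0); rewrite tab_charE /= expr0 mulr1 inordK ?ltnS //.
  rewrite expr1 -exprM -(expr0 z) (eq_prim_root_expr pz) mod0n modn_small; last first.
    case/and4P: ok => /eqP e _ _ _; rewrite e ltn_mul2l ltn_ord andbT.
    by case: (k) e.
  rewrite muln_eq0 negb_or; apply/andP; split; last by [].
  by case/and4P: ok => /eqP e _ _ _; case: (k) e.
have [b0|b0] := posnP b.
  by case/eqP: h; apply: val_inj => /=; have := ltn_ord c2; rewrite /B; lia.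
exists (0, inord 1); rewrite tab_charE /= expr0 mul1r inordK ?ltnS // expr1.
by rewrite -(expr0 z) (eq_prim_root_expr pz) mod0n modn_small.
Qed.

Lemma tab_sig_inj : injective tab_sig.
Proof. by case/and4P: ok => _ h _ _; exact: table_bij_inj h. Qed.

Lemma tab_sigD_inj : injective (fun x => tab_sig x + x).
Proof.
case/and4P: ok => _ _ h _ x y e; apply: (table_bij_inj h).
by rewrite -!tab_sig_enc -!tab_encD e.
Qed.

Lemma tab_sig_nonaffine c d :
  (forall x, tab_char c (tab_sig x) * tab_char d x = tab_char c (tab_sig 0) * tab_char d 0) ->
  c = 0 /\ d = 0.
Proof.
move=> h; case/and4P: ok => _ _ _ /allP/(_ (tab_enc c)).
rewrite mem_iota tab_enc_lt => /(_ isT) /allP /(_ (tab_enc d)).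
rewrite mem_iota tab_enc_lt => /(_ isT) /orP[/andP[/eqP c0 /eqP d0]|/hasP[x]].
  by split; apply: (can_inj tab_encK); rewrite ?c0 ?d0.
rewrite mem_iota add0n => /andP[_ xn] /eqP []; apply/eqP.
rewrite -(eq_prim_root_expr pz) exprD [X in _ == X]exprD; apply/eqP.
by have := h (tab_dec x); rewrite /tab_char !tab_sig_enc tab_decK.
Qed.

Lemma table_design : exists q : G * G -> G -> C, resolvable_design (square_co (@cm_lab G)) q /\
   forall o o', hdot (q o) (q o') =
     hdot (cm_phase tab_char tab_sig o) (cm_phase tab_char tab_sig o') / #|G|%:R.
Proof.
apply: complete_mapping_design.
- exact: tab_char_norm.
- exact: tab_charDl.
- exact: tab_charDr.
- exact: tab_char_nontriv.
- exact: tab_sig_inj.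
- exact: tab_sigD_inj.
- exact: tab_sig_nonaffine.
Qed.

End Table.

Section TableDesigns.
Variable C : numClosedFieldType.
Local Open Scope ring_scope.

Lemma has_design_table a b k s : table_ok a b k s -> has_design C (a.+1 * b.+1).
Proof.
move=> ok; have [z pz] := prim_root_exists C (ltn0Sn b).
have [q [rq _]] := table_design ok pz.
by have := has_design_card rq; rewrite card_prod !card_ord.
Qed.

(** The cells [(c, - c)] form a frame if [sigma - id] is a permutation. They meet
each row and each column once, and each transversal once if [c |-> c + c] is
a permutation. *)
Lemma has_framed_design_table a b k s h : table_ok a b k s -> table_mate a b s ->
  (h <= a.+1 * b.+1)%N -> has_framed_design C (a.+1 * b.+1) h.
Proof.
move=> ok /andP[m1 m2] hn; have [z pz] := prim_root_exists C (ltn0Sn b).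
have [q [rq qh]] := table_design ok pz.
pose G : finZmodType := ('I_a.+1 * 'I_b.+1)%type.
have cG : #|G| = (a.+1 * b.+1)%N by rewrite card_prod !card_ord.
have [S Sh] : exists S : {set G}, #|S| = h.
  exists [set x in take h (enum G)]; rewrite cardsE; have /card_uniqP -> := take_uniq h (enum_uniq G).
  by rewrite size_take_min -cardE cG; apply/minn_idPl.
have inj2 : injective (fun c : G => c + c).
  by move=> x y e; apply: (table_bij_inj m2); rewrite -!tab_encD e.
exists G, _, (square_co (@cm_lab G)), q, (fun c => (c, - c)), S; split=> //.

- move=> c c'; have [->|cc] := eqVneq c c'; first by case: rq => _ _ h1 _ _; exact: h1.
  rewrite qh (cm_orthogonal (@tab_char_norm a b k C z pz) (tab_charDl ok pz) (tab_charDr ok pz)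
    (tab_char_nontriv ok pz) (o := (c, - c)) (o' := (c', - c')) (k := -%R)) ?mul0r //=.
  + by rewrite subr_eq0.
  + move=> x; rewrite -opprB opprK [- c' + c]addrC.
    rewrite (bicharNr (@tab_char_norm a b k C z pz)  (tab_charDr ok pz)).
    by rewrite (bicharNl (@tab_char_norm a b k C z pz) (tab_charDl ok pz)).
  + move=> x y e; apply: (table_bij_inj m1).
    by rewrite -!tab_encN -!(tab_sig_enc ok) -!tab_encD e.
- case=> x y _ _ //=; first exact: oppr_inj.
  by rewrite /cm_lab -!opprD => /oppr_inj /inj2.
Qed.

Lemma has_framed_design_9 h : (h <= 9)%N -> has_framed_design C 9 h.
Proof.
by move=> h9; apply: (@has_framed_design_table 2 2 1 [:: 0; 3; 6; 2; 7; 4; 1; 8; 5]%N h) => //; vm_compute.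
Qed.

Lemma has_design_15 : has_design C 15.
Proof.
by apply: (@has_design_table 0 14 15 [:: 0; 1; 10; 3; 12; 6; 4; 2; 11; 5; 13;
  7; 8; 9; 14]%N); vm_compute.
Qed.

Lemma has_design_25 : has_design C 25.
Proof.
by apply: (@has_design_table 4 4 1 [:: 0; 14; 19; 5; 24; 21; 7; 3; 16; 8; 22; 9; 6; 12; 15; 13;
  1; 10; 23; 17; 2; 18; 4; 11; 20]%N); vm_compute.
Qed.

Lemma has_design_12 : has_design C 12.
Proof. by apply: (@has_design_table 1 5 3 [:: 0; 8; 6; 4; 9; 5; 11; 3; 7; 2; 10; 1]%N); vm_compute. Qed.

Lemma has_design_16 : has_design C 16.
Proof.
by apply: (@has_design_table 3 3 1 [:: 0; 13; 1; 5; 4; 10; 7; 14; 2; 9; 12; 6;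
  15; 3; 11; 8]%N); vm_compute.
Qed.

Lemma has_design_20 : has_design C 20.
Proof.
by apply: (@has_design_table 1 9 5 [:: 0; 6; 11; 15; 12; 14; 9; 5; 16; 2; 19; 4;
  8; 10; 7; 13; 1; 17; 18; 3]%N); vm_compute.
Qed.

(** Over [Z_2 * Z_4] the complete mapping with the values [s] makes the vectors
proportional for cells that differ by [(c, d) = ((0, 2), (1, 2))], and for no
others. Let the columns [d] with first component [1] carry an additional phase,
a cube root of unity on the [x] with even second component. This separates the
proportional pairs, and orthogonality survives, since on each line the cells
with different phases have inner products that vanish on even and on odd [x]
separately. In terms of a 12th root of unity, inner products vanish because
exponents [j] and [j + 6] occur equally often. *)
Section Order8.
Local Open Scope nat_scope.

Definition exp8 (c d x : nat) : nat :=
  let s := nth 0 [:: 0; 1; 6; 7; 3; 4; 5; 2] x in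
  (3 * (2 * (c %/ 4) * (s %/ 4) + (c %% 4) * (s %% 4) +
        2 * (d %/ 4) * (x %/ 4) + (d %% 4) * (x %% 4)) +
   4 * ((d %/ 4) * ~~ odd x)) %% 12.

Definition lab8 (c d : nat) : nat :=
  ((d %/ 4 + c %/ 4) %% 2) * 4 + ((d %% 4) + (4 - c %% 4)) %% 4.

Definition diff8 (c d c' d' : nat) : seq nat :=
  [seq (exp8 c d x + (12 - exp8 c' d' x)) %% 12 | x <- iota 0 8].

Definition balanced8 (l : seq nat) : bool :=
  all (fun j => count_mem j l == count_mem ((j + 6) %% 12) l) (iota 0 6).

Definition all8 (p : nat -> bool) := all p (iota 0 8).

Definition check8 : bool :=
  all8 (fun c => all8 (fun d => all8 (fun c' => all8 (fun d' =>
    [|| (c == c') && (d == d') |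
     let l := diff8 c d c' d' in
     [&& ([|| c == c', d == d' | lab8 c d == lab8 c' d'] ==> balanced8 l),
        ~~ all (pred1 (head 0 l)) l &
        (lab8 c d == lab8 c' d') ==> ((c != c') && (d != d'))]])))).
End Order8.

Lemma check8_ok : check8.
Proof. by vm_compute. Qed.

Lemma lab8_lt c d : (lab8 c d < 8)%N.
Proof.
rewrite /lab8; have := ltn_pmod (d %/ 4 + c %/ 4) (isT : 0 < 2)%N.
by have := ltn_pmod (d %% 4 + (4 - c %% 4)) (isT : 0 < 4)%N; lia.
Qed.

Lemma sum_count n (F : nat -> C) (l : seq nat) : all (fun j => j < n)%N l ->
  \sum_(j <- l) F j = \sum_(k < n) F k *+ count_mem (k : nat) l.
Proof.
elim: l => [_|j l IH /= /andP[jn /IH {}IH]].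
  by rewrite big_nil big1 // => k _; rewrite mulr0n.
rewrite big_cons IH; under [RHS]eq_bigr => k _ do rewrite mulrnDr.
rewrite big_split /=; congr (_ + _); rewrite (bigD1 (Ordinal jn)) //= eqxx mulr1n big1 ?addr0 // => k kj.
by rewrite (_ : (j == k :> nat) = false) ?mulr0n //; apply/negbTE; rewrite eq_sym.
Qed.

Lemma balanced8_sum (z : C) l : 12.-primitive_root z -> all (fun j => j < 12)%N l ->
  balanced8 l -> \sum_(j <- l) z ^+ j = 0.
Proof.
move=> pz l12 /allP bal; rewrite (sum_count _ l12) (@big_split_ord _ _ _ 6 6) /= -big_split.
have z6 : z ^+ 6 = -1.
  have : (z ^+ 6 == 1) || (z ^+ 6 == -1).
    by rewrite -sqrf_eq1 -exprM (prim_expr_order pz).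
  by rewrite -(prim_order_dvd pz) => /eqP.
apply: big1 => k _ /=; rewrite exprD z6.
have := bal k; rewrite mem_iota ltn_ord => /(_ isT) /eqP ->.
rewrite modn_small; last by have := ltn_ord k; lia.
by rewrite [(6 + k)%N]addnC mulN1r mulNrn subrr.
Qed.

Lemma nonconstant_entry n (l : seq nat) : size l = n -> ~~ all (pred1 (head 0%N l)) l ->
  exists x : 'I_n, nth 0%N l x != nth 0%N l 0.
Proof.
move=> sl /allPn[x xl hx]; have xi : (index x l < n)%N by rewrite -sl index_mem.
by exists (Ordinal xi); rewrite /= nth_index // nth0.
Qed.

Lemma has_design_8 : has_design C 8.
Proof.
have [z pz] := prim_root_exists C (isT : 0 < 12)%N.
have zn : `|z| = 1 := prim_root_norm pz.
have z0 : z != 0 by rewrite -normr_eq0 zn oner_eq0.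
pose lab (c d : 'I_8) : 'I_8 := inord (lab8 c d).
pose f (o : 'I_8 * 'I_8) (x : 'I_8) : C := z ^+ exp8 o.1 o.2 x.
have labE c d c' d' : lab c d = lab c' d' -> lab8 c d = lab8 c' d'.
  by move=> /(congr1 val); rewrite /= !inordK ?lab8_lt.
have chk (o o' : 'I_8 * 'I_8) (l := diff8 o.1 o.2 o'.1 o'.2) : o <> o' ->
    [/\ [|| o.1 == o'.1, o.2 == o'.2 | lab8 o.1 o.2 == lab8 o'.1 o'.2] -> balanced8 l,
        exists x : 'I_8, nth 0%N l x != nth 0%N l 0
      & lab8 o.1 o.2 == lab8 o'.1 o'.2 -> (o.1 != o'.1) && (o.2 != o'.2)].
  move=> ne; have i8 (i : 'I_8) : (i : nat) \in iota 0 8 by rewrite mem_iota ltn_ord.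
  move/allP/(_ _ (i8 o.1))/allP/(_ _ (i8 o.2))/allP/(_ _ (i8 o'.1))/allP/(_ _ (i8 o'.2)):
    check8_ok => /orP[/andP[/eqP h1 /eqP h2]|].
    by case: ne; apply: injective_projections; apply: val_inj.
  move=> /and3P[/implyP h1 h2 /implyP h3]; split=> //.
  by apply: nonconstant_entry h2; rewrite size_map size_iota.
have dif i j : (j < 12)%N -> z ^+ i / z ^+ j = z ^+ ((i + (12 - j)) %% 12).
  move=> lt; rewrite (prim_expr_mod pz) exprD; congr (_ * _).
  apply: (mulIf (expf_neq0 j z0)).
  by rewrite mulVf ?expf_neq0 // -exprD subnK ?(prim_expr_order pz) // ltnW.
have e12 c d x : (exp8 c d x < 12)%N by rewrite ltn_pmod.
have fl (o o' : 'I_8 * 'I_8) (x : 'I_8) : f o x / f o' x =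
    z ^+ nth 0%N (diff8 o.1 o.2 o'.1 o'.2) x.
  by rewrite /f dif // (nth_map 0%N) ?size_iota // nth_iota.
have [||||||q [rq _]] := @phase_design C 'I_8 ('I_8 * 'I_8)%type (square_co lab) f.
- by rewrite card_ord.
- by rewrite card_prod.
- move=> x y xy o o' [e1 e2]; have [//|/eqP ne] := eqVneq o o'.
  have [_ _ h] := chk _ _ ne.
  have h' : (lab8 o.1 o.2 == lab8 o'.1 o'.2) -> (o.1 == o'.1) || (o.2 == o'.2) -> False.
    by move=> /h /andP[/negbTE -> /negbTE ->].
  case: x y e1 e2 xy => -[] //= e1 e2 _.
  + exact: injective_projections.
  + by case: h'; rewrite ?(labE _ _ _ _ e2) ?e1 ?eqxx.
  + exact: injective_projections.
  + by case: h'; rewrite ?(labE _ _ _ _ e2) ?e1 ?eqxx ?orbT.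
  + by case: h'; rewrite ?(labE _ _ _ _ e1) ?e2 ?eqxx.
  + by case: h'; rewrite ?(labE _ _ _ _ e1) ?e2 ?eqxx ?orbT.
- by move=> o x; rewrite /f normrX zn expr1n.
- move=> x o o' e ne; have [h1 _ _] := chk _ _ ne.
  transitivity (\sum_(j <- diff8 o.1 o.2 o'.1 o'.2) z ^+ j).
    rewrite big_map -[8%N]/(8 - 0)%N -/(index_iota 0 8) big_mkord.
    apply: eq_bigr => i _; rewrite -dif ?e12 // /f; congr (_ * _).
    by rewrite invC_norm normrX zn !expr1n invr1 mul1r.
  apply: balanced8_sum => //.
    by apply/allP => j /mapP[i _ ->]; rewrite ltn_pmod.
  apply: h1; case: x e => /= e; first by rewrite e eqxx.
    by rewrite e eqxx orbT.
  by rewrite (labE _ _ _ _ e) eqxx !orbT.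
- move=> o o' a e; have [//|/eqP/chk [_ [x /eqP hx] _]] := eqVneq o o'.
  case: hx; have fa y : f o y / f o' y = a.
    by rewrite e mulfK // /f expf_neq0.
  have : z ^+ nth 0%N (diff8 o.1 o.2 o'.1 o'.2) x =
         z ^+ nth 0%N (diff8 o.1 o.2 o'.1 o'.2) (ord0 : 'I_8).
    by rewrite -!fl !fa.
  move/eqP; rewrite (eq_prim_root_expr pz).
  have n12 (i : 'I_8) : (nth 0%N (diff8 o.1 o.2 o'.1 o'.2) i < 12)%N.
    by rewrite (nth_map 0%N) ?size_iota // ltn_pmod.
  by rewrite !modn_small // => /eqP.
by have := has_design_card rq; rewrite card_ord.
Qed.

End TableDesigns.

(** * Closure properties of the set of orders *)

Section Arithmetic.
Local Open Scope nat_scope.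

Variable C : numClosedFieldType.

Lemma has_design_framed n h : has_framed_design C n h -> has_design C n.
Proof. by move=> [V [Om [co [q [b [S [Vn rq _ _ _]]]]]]]; exists V, Om, co, q. Qed.

Lemma has_design_0 : has_design C 0.
Proof.
exists void, void, (fun _ o => o), (fun _ _ => 0%R); split; first exact: card_void.
by split=> [|? ? _ []|[]|? []|[]]; rewrite ?card_void.
Qed.

Lemma has_design_1 : has_design C 1.
Proof.
exists unit, unit, (fun _ o => o), (fun _ _ => 1%R); split; first exact: card_unit.
split=> [|? ? _ [] []|_|? [] []|[] []] //; first by rewrite card_unit.
by rewrite /hdot (eq_bigr (fun=> 1%R)) ?sumr_const ?card_unit // => i _; rewrite conjC1 mulr1.
Qed.

(** A block has at most one extra point in each group, hence at most [#|G|]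
holes. *)
Lemma has_design_wilson (G : finType) (m t : nat) (u : G -> nat) :
    1 < m -> 0 < t -> has_TD (4 + #|G|) t -> (forall g, u g <= t) -> (forall g, has_design C (u g)) ->
    (forall h, h <= #|G| -> has_framed_design C (m + h) h) ->
  has_design C (t * m + \sum_g u g).
Proof.
move=> m1 t0 [T [psi [Tt psi_inj]]] ut RQu RQm.
have [x0 _] : exists x0 : T, x0 \in T by apply/card_gt0P; rewrite Tt.
pose U g : {set T} := [set x in take (u g) (enum T)].
have cU g : #|U g| = u g.
  rewrite cardsE; have /card_uniqP -> := take_uniq (u g) (enum_uniq T).
  by rewrite size_take_min -cardE Tt; apply/minn_idPl.
pose idx (x : option line_kind + G) : nat := match x with
  inl None => 0 | inl (Some Row) => 1 | inl (Some Col) => 2 | inl (Some Tra) => 3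
  | inr g => 4 + enum_rank g end.
have idx_lt x : idx x < 4 + #|G| by case: x => [[[]|]|g] //=; rewrite ltn_add2l.
have idx_inj x y : x <> y -> idx x <> idx y.
  by case: x y => [[[]|]|g] [[[]|]|g'] //= ne [/val_inj/enum_rank_inj e]; apply: ne; rewrite e.
have := @wilson_fill C T 'I_m G (fun x => psi (idx x)) U x0.
rewrite card_ord Tt; under eq_bigr => g _ do rewrite cU; apply=> //.
- by move=> x y /idx_inj ne; exact: psi_inj.
- by move=> b; apply: RQm; exact: max_card.
- by move=> g; rewrite cU.
Qed.

Lemma has_design_mul m t : 1 < m -> 0 < t -> has_TD 4 t -> has_design C m -> has_design C (t * m).
Proof.
move=> m1 t0 td rq; have := @has_design_wilson void m t (fun=> 0) m1 t0.
rewrite card_void !addn0 => /(_ td); rewrite big_pred0 ?addn0; last by case.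
by apply=> // h; rewrite leqn0 => /eqP ->; rewrite addn0; exact: has_framed_design0.
Qed.

Lemma has_design_truncate m t u : 1 < m -> 0 < t -> u <= t -> has_TD 5 t ->
  has_design C m -> has_design C m.+1 -> has_design C u -> has_design C (t * m + u).
Proof.
move=> m1 t0 ut td rq rq1 rqu; have := @has_design_wilson unit m t (fun=> u) m1 t0.
rewrite card_unit => /(_ td); rewrite (big_pred1 tt); last by case.
apply=> // -[|[|h]] // _; first by rewrite addn0; exact: has_framed_design0.
by rewrite addn1; apply: has_framed_design1.
Qed.

Lemma has_design_truncate2 m t u v : 1 < m -> 0 < t -> u <= t -> v <= t -> has_TD 6 t ->
  has_design C m -> has_design C m.+1 -> has_framed_design C m.+2 2 ->
  has_design C u -> has_design C v -> has_design C (t * m + (u + v)).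
Proof.
move=> m1 t0 ut vt td rq rq1 rq2 rqu rqv.
have := @has_design_wilson bool m t (fun b => if b then u else v) m1 t0.
rewrite card_bool => /(_ td); rewrite big_bool /=.
apply=> [[]|[]|[|[|[|h]]]] // _; first by rewrite addn0; exact: has_framed_design0.
  by rewrite addn1; apply: has_framed_design1.
by rewrite addn2.
Qed.

(** Unless [v] has a prime factor [p >= 7], two of its prime factors, counted with
multiplicity, are 3 or 5, and have the product 9, 15 or 25. *)
Lemma has_design_odd v : odd v -> 7 <= v -> has_design C v.
Proof.
move=> ov v7.
have step b : b %| v -> 1 < b -> has_design C b -> has_design C v.
  move=> /dvdnP[m vE] b1 rq; rewrite vE in ov v7 *.
  apply: has_design_mul => //; first by case: m v7 {ov vE}.
  by apply: TD4_odd; move: ov; rewrite oddM => /andP[].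
have p1 : prime (pdiv v) by apply: pdiv_prime; lia.
have d1 := pdiv_dvd v; set w := v %/ pdiv v; have vw : v = w * pdiv v by rewrite divnK.
have prm p : prime p -> p %| v -> has_design C v \/ p = 3 \/ p = 5.
  move=> pp pv; have [p7|] := leqP 7 p.
    by left; apply: (step p) => //; [lia|apply: has_design_prime].
  have op : odd p by exact: dvdn_odd pv ov.
  by case: p pp op pv => [|[|[|[|[|[|[|p]]]]]]] //; auto.
have [//|p35] := prm _ p1 d1.
have w1 : 1 < w by move: v7; rewrite vw; case: p35 => ->; lia.
have d2 : pdiv w * pdiv v %| v by rewrite {2}vw dvdn_mul ?pdiv_dvd.
have [//|q35] := prm _ (pdiv_prime w1) (dvdn_trans (dvdn_mulr _ (dvdnn _)) d2).
apply: (step _ d2); first by case: p35 q35 => -> [] ->.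
case: p35 q35 => -> [] ->.
- exact: has_design_framed (has_framed_design_9 C (leq0n 9)).
- exact: has_design_15.
- exact: has_design_15.
- exact: has_design_25.
Qed.

(** If 8 divides [v], the cofactor of 8 or of 16 is odd or a multiple of 4.
Otherwise [v] is 12, 20, or 4 times an odd number that is at least 7. *)
Lemma has_design_mul4 v : 4 %| v -> 8 <= v -> has_design C v.
Proof.
move=> d4 v8; have step b m : v = m * b -> 1 < b -> has_design C b -> 4 %| m \/ odd m -> has_design C v.
  move=> vE b1 rq hm; have m0 : 0 < m by case: m vE {hm} => //; lia.
  by rewrite vE; apply: has_design_mul => //; case: hm => [/(TD4_mul4 m0)|/TD4_odd].
have [o4|e4] := boolP (odd (v %/ 4)).
  have [k7|k7] := leqP 7 (v %/ 4).
    by apply: (step (v %/ 4) 4); [lia|lia|exact: has_design_odd|left].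
  have [->|->] : v = 12 \/ v = 20 by lia.
    exact: has_design_12.
  exact: has_design_20.
have [d16|n16] := boolP (odd (v %/ 16) && (16 %| v)).
  by apply: (step 16 (v %/ 16)); [lia|lia|exact: has_design_16|right; lia].
by apply: (step 8 (v %/ 8)); [lia|lia|exact: has_design_8|lia].
Qed.

End Arithmetic.

(** * All orders *)

Section Orders.
Local Open Scope nat_scope.

Variable C : numClosedFieldType.

(** Orders of designs by which truncated groups can be filled, including the
trivial orders 0 and 1. *)
Definition fillable u := [|| u <= 1, odd u && (7 <= u) | (4 %| u) && (8 <= u)].

Lemma has_design_fillable u : fillable u -> has_design C u.
Proof.
case/or3P => [|/andP[]|/andP[]]; [|exact: has_design_odd|exact: has_design_mul4].
by case: u => [|[|u]] // _; [exact: has_design_0|exact: has_design_1].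
Qed.

(** [v = t * m + u] with [u <= t], where blocks of sizes [m] and [m.+1] and the
truncated group of size [u] can all be filled. *)
Definition truncates m t v :=
  [&& fillable m, fillable m.+1, 1 < m, 0 < t & [&& t * m <= v, v <= t * m.+1 & fillable (v - t * m)]].

Lemma has_design_truncates m t v : has_TD 5 t -> truncates m t v -> has_design C v.
Proof.
move=> td /and5P[m1 m2 m3 t0 /and3P[le1 le2 fu]].
rewrite -(subnKC le1); apply: has_design_truncate => //; try exact: has_design_fillable.
by rewrite leq_subLR addnC -mulnS.
Qed.

Lemma coprime6E t : coprime t 6 = (t %% 6 == 1) || (t %% 6 == 5).
Proof. by rewrite -coprime_modl; have := ltn_pmod t (isT : 0 < 6); case: (t %% 6) => [|[|[|[|[|[|n]]]]]]. Qed.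

(** From 7 to 279, each order 2 mod 4 that is not excluded has the form
[t * m + u] with one truncated group, except for the eight orders in the second
list. *)
Definition small_check : bool :=
  all (fun i => let v := 4 * i + 2 in
    [|| v < 7, v \in [:: 10; 14; 18; 22; 26; 30; 34; 38; 42; 46; 54; 58; 62; 66; 74; 82; 94],
      v \in [:: 70; 90; 110; 250; 114; 118; 138; 158],
      has (fun t => coprime t 6 && truncates 7 t v) (iota 5 35) |
      has (fun p => coprime p.2 6 && truncates p.1 p.2 v)
        [:: (15, 7); (11, 11); (11, 13); (15, 11); (11, 17); (15, 13)]])
    (iota 0 70).

Lemma small_check_ok : small_check.
Proof. by vm_compute. Qed.

Lemma has_design_of_order v : 7 <= v -> v \notin [:: 10; 14; 18; 22; 26; 30; 34; 38; 42; 46;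
    54; 58; 62; 66; 74; 82; 94] -> has_design C v.
Proof.
move=> v7 ve.
have [ov|ev] := boolP (odd v); first exact: has_design_odd.
have [v4|v4] := boolP (4 %| v); first by apply: has_design_mul4; lia.
have td5 t : 0 < t -> coprime t 6 -> has_TD 5 t.
  by move=> t0 ct; apply: TD_le (TD6_coprime6 t0 ct).
have [small|large] := ltnP v 280; last first.
  have [t [tc h1 h2]] : exists t, [/\ coprime t 6, 7 * t + 7 <= v & v <= 8 * t].
    pose t0 := (v + 7) %/ 8; pose r := t0 %% 6.
    have r6 : r < 6 by rewrite ltn_pmod.
    (* the list gives the distance from a residue mod 6 to the next unit *)
    exists (t0 + nth 0 [:: 1; 0; 3; 2; 1; 0] r); split.
    - rewrite coprime6E -modnDml -/r; by case: r r6 => [|[|[|[|[|[|r]]]]]].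
    - have : nth 0 [:: 1; 0; 3; 2; 1; 0] r <= 3 by case: r r6 => [|[|[|[|[|[|r]]]]]].
      rewrite /t0; lia.
    by rewrite /t0; lia.
  have ot : odd t by move: tc; rewrite coprime6E; lia.
  apply: (@has_design_truncates 7 t); first by apply: td5; lia.
  apply/and5P; split=> //; first lia.
  by apply/and3P; split; try lia; rewrite /fillable; apply/or3P; apply: Or32; lia.
have vE : v = 4 * (v %/ 4) + 2 by lia.
have /allP/(_ (v %/ 4)) := small_check_ok; rewrite mem_iota => /(_ ltac:(lia)).
cbv beta zeta; rewrite -vE (negbTE ve) => /or4P[|//|| /orP[/hasP[t]|/hasP[[m t]]]]; first lia.
- have prod10 m : 1 < m -> has_design C m -> has_design C (10 * m) by move=> m1; apply: has_design_mul TD4_10.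
  have trunc2 t u w : coprime t 6 -> 0 < t -> u <= t -> w <= t -> has_design C u -> has_design C w ->
      has_design C (t * 7 + (u + w)).
    move=> ct t0 ut wt ru rw; apply: has_design_truncate2 => //; try exact: has_design_odd.
    - exact: TD6_coprime6.
    - exact: has_design_mul4.
    exact: has_framed_design_9.
  rewrite !inE => /or4P[/eqP->|/eqP->|/eqP->|/or4P[/eqP->|/eqP->|/eqP->|/orP[/eqP->|/eqP->]]].
  + by apply: (prod10 7) => //; apply: has_design_odd.
  + by apply: (prod10 9) => //; apply: has_design_odd.
  + by apply: (prod10 11) => //; apply: has_design_odd.
  + by apply: (prod10 25) => //; apply: has_design_odd.
  + exact: (has_design_truncates (m := 7) TD5_15).
  + exact: (has_design_truncates (m := 7) TD5_15).
  + by apply: (trunc2 17 8 11) => //; [exact: has_design_mul4|exact: has_design_odd].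
  + by apply: (trunc2 19 12 13) => //; [exact: has_design_mul4|exact: has_design_odd].
- by move=> _ /andP[tc tr]; apply: (has_design_truncates _ (tr)); apply: td5 => //; case/and5P: (tr).
- by move=> _ /andP[/= tc tr]; apply: (has_design_truncates _ (tr)); apply: td5 => //; case/and5P: (tr).
Qed.

End Orders.

(** * From designs to quantum Latin squares *)

Section Array.
Variables (R : realType) (v : nat).
Variables (lab : 'I_v -> 'I_v -> 'I_v) (q : 'I_v * 'I_v -> 'I_v -> R[i]).
Hypothesis rq : resolvable_design (square_co lab) q.

Definition array_of : qarray R v := fun c => \row_s q c s.

Lemma dotmx_array c d : dotmx (array_of c) (array_of d) = hdot (q c) (q d).
Proof. by rewrite dotmxE !mxE; apply: eq_bigr => s _; rewrite !mxE. Qed.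

(** Orthonormal vectors are free. *)
Lemma basis_of_orthonormal (A : {set cell v}) : #|A| = v ->
    (forall c d, c \in A -> d \in A -> c <> d -> hdot (q c) (q d) = 0) ->
  entries_orthonormal_basis array_of A.
Proof.
move=> cA ort; have [_ _ q1 _ _] := rq.
have ob c d : c \in A -> d \in A -> dotmx (array_of c) (array_of d) = (c == d)%:R.
  move=> cA' dA; rewrite dotmx_array; have [->|/eqP ne] := eqVneq c d; first exact: q1.
  by rewrite ort.
split=> //; rewrite basisEfree subvf dimvf size_image cA /dim /= mul1n leqnn !andbT.
set X := [seq array_of c | c in A]; have -> : X = tval (in_tuple X) by [].
apply/freeP => k; rewrite in_tupleE => k0 i.
have lt (j : 'I_(size X)) : (j < size (enum A))%N by rewrite -(size_map array_of); exact: ltn_ord.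
have c0 : cell v by case: (enum A) (lt i) => // c.
have Xj (j : 'I_(size X)) : X`_j = array_of (nth c0 (enum A) j) by rewrite (nth_map c0).
have inA (j : 'I_(size X)) : nth c0 (enum A) j \in A by rewrite -mem_enum mem_nth.
have := congr1 (fun u => dotmx u X`_i) k0.
rewrite linear_sumlz /= linear0l.
rewrite (bigD1 i) //= linearZl_LR /= Xj ob // eqxx mulr1 big1 ?addr0 // => j ji.
rewrite linearZl_LR /= !Xj ob // nth_uniq ?enum_uniq // (inj_eq val_inj) (negbTE ji).
by rewrite mulr0.
Qed.

Lemma card_line x a : #|[set c | square_co lab x c == a]| = v.
Proof.
have [y xy] : exists y, x <> y by case: x; [exists Col|exists Row|exists Row].
have [g gK Kg] := coordinates_bij rq xy.
have -> : [set c | square_co lab x c == a] = [set g (a, i) | i : 'I_v].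
  apply/setP => c; rewrite inE; apply/eqP/imsetP => [<-|[i _ ->]].
    by exists (square_co lab y c); rewrite // gK.
  by have [] := Kg (a, i).
rewrite card_imset ?card_ord // => i j /(congr1 (square_co lab y)).
by have [_ ->] := Kg (a, i); have [_ ->] := Kg (a, j).
Qed.

Lemma card_line2 x y a b : x <> y ->
  #|[set c | (square_co lab x c == a) && (square_co lab y c == b)]| = 1%N.
Proof.
move=> xy; have [g gK Kg] := coordinates_bij rq xy.
rewrite -(cards1 (g (a, b))); apply: eq_card => c; rewrite !inE.
by rewrite -(can_eq gK) Kg.
Qed.

Lemma line_orthonormal x a :
  entries_orthonormal_basis array_of [set c | square_co lab x c == a].
Proof.
apply: basis_of_orthonormal; first exact: card_line.
move=> c d; rewrite !inE => /eqP ca /eqP da; have [_ _ _ q0 _] := rq.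
by apply: (q0 x); rewrite ca da.
Qed.

Lemma array_resolvable : is_RQLS 1 array_of.
Proof.
split; first by split=> i; [exact: (line_orthonormal Row)|exact: (line_orthonormal Col)].
exists (fun _ i => [set c | square_co lab Tra c == i]); split=> [r i|r i j ij|r s i j].
- split; [exact: card_line| | |exact: line_orthonormal].
  + move=> j; rewrite -(@card_line2 Tra Row i j) //; apply: eq_card => c.
    by rewrite !inE.
  + move=> j; rewrite -(@card_line2 Tra Col i j) //; apply: eq_card => c.
    by rewrite !inE.
- rewrite -setI_eq0; apply/eqP/setP => c; rewrite !inE.
  by apply/negbTE; apply: contra ij => /andP[/eqP <- /eqP <-].
- by rewrite !ord1 eqxx.
Qed.

Lemma array_maximal : maximal_cardinality array_of.
Proof.
rewrite /maximal_cardinality /QLS_cardinality card_imset; first by rewrite card_prod card_ord mulnn.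
move=> c d e; have [_ _ _ _ qp] := rq.
have : d \in [set x | `[< same_up_to_phase (array_of d) (array_of x) >]].
  rewrite inE; apply/asboolP; exists 0.
  rewrite cos0 sin0; apply/rowP => s; rewrite !mxE.
  by rewrite -[LHS]mul1r; congr (_ * _).
rewrite -e inE => /asboolP[t ht]; apply: (qp _ _ (cos t +i* sin t)%C) => s.
by have /rowP/(_ s) := ht; rewrite !mxE.
Qed.

End Array.

Theorem theorem1p3 (R : realType) (v : nat) (hv : (7 <= v)%N)
    (hv_exc : v \notin [:: 10; 14; 18; 22; 26; 30; 34; 38; 42; 46; 54; 58; 62;
                           66; 74; 82; 94]%N) :
  exists Q : qarray R v, is_RQLS 1 Q /\ maximal_cardinality Q.
Proof.
have [lab [q [rq _]]] := square_with_holes (H := set0 : {set 'I_v})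
  (has_framed_design0 (has_design_of_order R[i] hv hv_exc)) (card_ord v) (cards0 _).
by exists (array_of q); split; [exact: array_resolvable rq|exact: array_maximal rq].
Qed.
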